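(* Let $\Omega\subset\mathbb{R}^2$ be a contractible polygonal domain and $\mathcal{T}_h$ a mesh of $\Omega$ consisting of squares. With the spaces defined in the context, (a) $\operatorname{curl}\mathcal{A}_3\Lambda^0(\mathcal{T}_h)\subset\tilde{\mathcal{A}}_2\Lambda^1(\mathcal{T}_h)$; (b) $\operatorname{div}\tilde{\mathcal{A}}_2\Lambda^1(\mathcal{T}_h)\subset\tilde{\mathcal{A}}_1\Lambda^2(\mathcal{T}_h)$; (c) the complex $$0\to\mathbb{R}\to\mathcal{A}_3\Lambda^0(\mathcal{T}_h)\xrightarrow{\operatorname{curl}}\tilde{\mathcal{A}}_2\Lambda^1(\mathcal{T}_h)\xrightarrow{\operatorname{div}}\tilde{\mathcal{A}}_1\Lambda^2(\mathcal{T}_h)\to0$$ is exact, where $\mathbb{R}\to\mathcal{A}_3\Lambda^0(\mathcal{T}_h)$ is the inclusion of constants.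
   Context: Squares are axis-parallel and the mesh is conforming (edge-to-edge). $\operatorname{curl}u=(-\partial_2u,\partial_1u)^T$ for scalar $u$; $\mathcal{P}_r$ denotes polynomials of total degree at most $r$. - $\mathcal{A}_3\Lambda^0(\mathcal{T}_h)$ (Adini element): shape functions on each square $\mathcal{P}_3+\mathrm{span}\{x^3y,xy^3\}$; degrees of freedom are the value and the two first order partial derivatives at each vertex. - $\tilde{\mathcal{A}}_2\Lambda^1(\mathcal{T}_h)$: shape functions on each square $[\mathcal{P}_1]^2+\mathrm{span}\{\operatorname{curl}(x^3),\operatorname{curl}(y^3),\operatorname{curl}(x^2y),\operatorname{curl}(xy^2),\operatorname{curl}(x^3y),\operatorname{curl}(xy^3)\}$; degrees of freedom are the vector value at each vertex and $\int_e\bm u\cdot\bm\nu_e$ on each edge $e$ ($\bm\nu_e$ a unit normal). - $\tilde{\mathcal{A}}_1\Lambda^2(\mathcal{T}_h)$: piecewise constants. Each global space consists of the piecewise shape functions whose vertex and edge degrees of freedom are single-valued on shared vertices and edges. Exactness means that the kernel of each map equals the image of the preceding one; in particular $\operatorname{div}$ is onto. *)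

(* Defs.v *)
From HB Require Import structures.
From mathcomp Require Import all_boot all_order all_algebra.
From mathcomp Require Import all_classical all_reals all_analysis.
Import Order.TTheory GRing.Theory Num.Theory.
Import numFieldNormedType.Exports.

Set Implicit Arguments.
Unset Strict Implicit.
Unset Printing Implicit Defensive.

Local Open Scope classical_set_scope.
Local Open Scope ring_scope.

Section Domain.
Variable R : realType.
Implicit Types (D : set (R * R)).

Definition boundary D : set (R * R) := closure D `\` D°.

Definition segment (ab : (R * R) * (R * R)) : set (R * R) :=
  (fun t : R => (1 - t) *: ab.1 + t *: ab.2) @` `[0, 1].

(* Near each boundary point [z], in the orthonormal frame
   [(c, s), (- s, c)] at [z], the set is the strict epigraph of a Lipschitz
   function; this rules out slits and boundaries that touch themselves. *)
Definition lipschitz_boundary D : Prop :=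
  forall z, boundary D z ->
  exists (c s r L : R) (phi : R -> R),
    [/\ c ^+ 2 + s ^+ 2 = 1, 0 < r, L.-lipschitz phi &
     forall xi eta : R, `|xi| < r -> `|eta| < r ->
       D (z + xi *: (c, s) + eta *: (- s, c)) <-> phi xi < eta].

Definition polygonal_domain D : Prop :=
  [/\ [/\ D !=set0, open D & connected D], bounded_set D,
      exists S : seq ((R * R) * (R * R)),
        boundary D = \bigcup_(ab in [set` S]) segment ab &
      lipschitz_boundary D].

Definition contractible D : Prop :=
  exists2 z0, D z0 &
  exists H : (R * R) * R -> R * R,
    [/\ {within D `*` `[0, 1], continuous H},
        forall z (t : R), D z -> t \in `[0, 1] -> D (H (z, t)),
        forall z, D z -> H (z, 0) = z &
        forall z, D z -> H (z, 1) = z0].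

End Domain.

(* [corner K] is the lower left corner of the square [K]. *)
Record square_family (R : realType) := SquareFamily {
  cell :> finType;
  corner : cell -> R * R;
  side : cell -> R;
  side_gt0 : forall K, 0 < side K }.

Section Mesh.
Variables (R : realType) (T : square_family R).
Implicit Types (K L : T).

Definition square K : set (R * R) :=
  `[(corner K).1, (corner K).1 + side K] `*`
  `[(corner K).2, (corner K).2 + side K].

Definition vertex K (i : bool * bool) : R * R :=
  corner K + ((side K) *+ i.1, (side K) *+ i.2).

(* An edge index [e] says whether the edge is vertical ([e.1]) and whether it
   is the right or upper one of the two parallel edges ([e.2]). *)
Definition edge_tangent (e : bool * bool) : R * R :=
  if e.1 then (0, 1) else (1, 0).

(* The same unit normal is used from both sides of a shared edge. *)
Definition edge_normal (e : bool * bool) : R * R :=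
  if e.1 then (1, 0) else (0, 1).

Definition edge_point K (e : bool * bool) (t : R) : R * R :=
  corner K + ((side K) *+ e.2) *: edge_normal e + t *: edge_tangent e.

Definition edge K (e : bool * bool) : set (R * R) :=
  edge_point K e @` `[0, side K].

Definition conforming : Prop :=
  forall K L, K != L ->
  [\/ square K `&` square L = set0,
      exists i j, vertex K i = vertex L j /\
        square K `&` square L = [set vertex K i] |
      exists e f, edge K e = edge L f /\
        square K `&` square L = edge K e].

Definition mesh_of (D : set (R * R)) : Prop :=
  closure D = \bigcup_K square K /\ conforming.

End Mesh.

(* Polynomials in [x] and [y] are elements of [{poly {poly R}}], with ['X]
   standing for [x] and ['Y] for [y], so that [p`_i`_j] is the coefficient of
   [x ^ i * y ^ j].  Squares having nonempty interior, a polynomial is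
   identified with its restriction to a square. *)
Section Polynomials.
Variable R : realType.
Local Notation P := {poly {poly R}}.

Definition ev (p : P) (z : R * R) : R := p.[z.1, z.2].

Definition d1 (p : P) : P := p^`().
Definition d2 (p : P) : P := map_poly (@deriv R) p.
Definition curl (p : P) : P * P := (- d2 p, d1 p).
Definition div (u : P * P) : P := d1 u.1 + d2 u.2.

Definition totdeg_le (r : nat) : set P :=
  [set p : P | forall i j, (p`_i : {poly R})`_j != 0 -> (i + j <= r)%N].

(* The span over [R]: the coefficients are constants of [{poly R}]. *)
Definition scalar_span (V : lmodType {poly R}) (s : seq V) : set V :=
  [set v | exists c : nat -> R, v = \sum_(i < size s) (c i)%:P *: s`_i].

Definition adini_shape : set P :=
  [set p + q | p in totdeg_le 3 & q in scalar_span [:: 'X^3 * 'Y; 'X * 'Y ^+ 3]].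

Definition vector_shape : set (P * P) :=
  [set v + w | v in totdeg_le 1 `*` totdeg_le 1 &
               w in scalar_span [:: curl 'X^3; curl ('Y ^+ 3);
                             curl ('X^2 * 'Y); curl ('X * 'Y ^+ 2);
                             curl ('X^3 * 'Y); curl ('X * 'Y ^+ 3)]].

End Polynomials.

Section Spaces.
Variables (R : realType) (T : square_family R).
Local Notation P := {poly {poly R}}.

Definition edge_flux (K : T) (e : bool * bool) (u : P * P) : R :=
  \int[lebesgue_measure]_(t in `[0, side K])
    (ev u.1 (edge_point K e t) * (edge_normal R e).1 +
     ev u.2 (edge_point K e t) * (edge_normal R e).2).

Definition single_valued_at_vertices (V : Type) (dof : T -> R * R -> V) :=
  forall (K L : T) i j, vertex K i = vertex L j ->
    dof K (vertex K i) = dof L (vertex L j).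

Definition single_valued_on_edges (V : Type) (dof : T -> bool * bool -> V) :=
  forall (K L : T) e f, edge K e = edge L f -> dof K e = dof L f.

Definition A3Lambda0 : set {ffun T -> P} :=
  [set u | (forall K, adini_shape (u K)) /\
    single_valued_at_vertices
      (fun K z => (ev (u K) z, ev (d1 (u K)) z, ev (d2 (u K)) z))].

Definition A2Lambda1 : set {ffun T -> P * P} :=
  [set u | [/\ forall K, vector_shape (u K),
    single_valued_at_vertices (fun K z => (ev (u K).1 z, ev (u K).2 z)) &
    single_valued_on_edges (fun K e => edge_flux K e (u K))]].

Definition A1Lambda2 : set {ffun T -> P} :=
  [set w | forall K, totdeg_le 0 (w K)].

Definition const_h (c : R) : {ffun T -> P} := [ffun=> c%:P%:P].
Definition curl_h (u : {ffun T -> P}) : {ffun T -> P * P} :=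
  [ffun K => curl (u K)].
Definition div_h (u : {ffun T -> P * P}) : {ffun T -> P} :=
  [ffun K => div (u K)].

End Spaces.

(* Exactness at [B] of [A --f--> B --g--> _]. *)
Definition exact_at (U V : Type) (W : zmodType)
    (A : set U) (f : U -> V) (B : set V) (g : V -> W) : Prop :=
  f @` A = [set v | B v /\ g v = 0].

(* Main.v *)
Require Import Defs.
From HB Require Import structures.
From mathcomp Require Import all_boot all_order all_algebra.
From mathcomp Require Import all_classical all_reals all_analysis.
From mathcomp Require Import ring lra.
Import Order.TTheory GRing.Theory Num.Theory.
Import numFieldNormedType.Exports.
Local Open Scope classical_set_scope.
Local Open Scope ring_scope.

(* Locally the kernel of [div] consists of curls: on each square a divergence-free
   field is the curl of an Adini polynomial, unique up to a constant.  On a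
   shared edge two such potentials differ by a cubic with vanishing derivative
   at the ends (vertex values) and equal end values (flux), i.e. by a constant.
   So the potentials of two meeting squares differ by a constant [d K L], and
   Helly's theorem for boxes makes [d] a cocycle on pairwise meeting squares.

   To trivialize [d], pull it back to pairs of nearby points [z], [w] of the
   domain, using a square containing [z] and one containing [w].  Summing it
   along the trajectories of the contraction yields a function [phi] on a
   compact subset of the open domain whose increments are the pulled-back
   cocycle.  With [kappa z] the chosen square containing [z], the function
   [z |-> phi z + d (kappa z) K] is locally constant near [K],
   and comparing its values at the centres of two meeting squares is possible as
   soon as these centres are joined inside the domain by a path staying near
   the two squares; the Lipschitz charts provide it even when the squares meet
   only at a boundary point.

   Surjectivity of [div] needs no topology: push everything produced in a
   row of squares to the right, with fields vanishing at all vertices. *)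

Set Implicit Arguments.
Unset Strict Implicit.
Unset Printing Implicit Defensive.

(** * Differentiation, evaluation and total degree of bivariate polynomials *)

Section BivariatePolynomials.
Variable R : realType.
Local Notation P := {poly {poly R}}.
Implicit Types (p q : P) (z : R * R).

Definition mono i j : P := 'X^i * ('Y ^+ j).

Lemma d1D p q : d1 (p + q) = d1 p + d1 q.
Proof. by rewrite /d1 derivD. Qed.

Lemma d1N p : d1 (- p) = - d1 p.
Proof. by rewrite /d1 derivN. Qed.

Lemma d1M p q : d1 (p * q) = d1 p * q + p * d1 q.
Proof. by rewrite /d1 derivM. Qed.

Lemma d1C (c : {poly R}) : d1 c%:P = 0.
Proof. by rewrite /d1 derivC. Qed.

Lemma d1X : d1 ('X : P) = 1.
Proof. by rewrite /d1 derivX. Qed.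

Lemma coef_d2 p i : (d2 p)`_i = deriv p`_i.
Proof. by rewrite /d2 coef_map_id0 ?deriv0. Qed.

Lemma d2D p q : d2 (p + q) = d2 p + d2 q.
Proof. by apply/polyP => i; rewrite coefD !coef_d2 coefD derivD. Qed.

Lemma d2N p : d2 (- p) = - d2 p.
Proof. by apply/polyP => i; rewrite coefN !coef_d2 coefN derivN. Qed.

Lemma d2M p q : d2 (p * q) = d2 p * q + p * d2 q.
Proof.
apply/polyP => i; rewrite coefD coef_d2 !coefM linear_sum -big_split /=.
by apply: eq_bigr => j _; rewrite derivM !coef_d2.
Qed.

Lemma d2C (c : {poly R}) : d2 c%:P = (c^`())%:P.
Proof. by apply/polyP => i; rewrite coef_d2 !coefC; case: eqP; rewrite ?deriv0. Qed.

Lemma d2X : d2 ('X : P) = 0.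
Proof.
by apply/polyP => i; rewrite coef_d2 coefX coef0; case: eqP; rewrite ?deriv0 ?derivC.
Qed.

Lemma d1CC (c : R) : d1 c%:P%:P = 0. Proof. exact: d1C. Qed.
Lemma d2CC (c : R) : d2 c%:P%:P = 0. Proof. by rewrite d2C derivC. Qed.
Lemma d1Y : d1 ('Y : P) = 0. Proof. exact: d1C. Qed.
Lemma d2Y : d2 ('Y : P) = 1. Proof. by rewrite d2C derivX. Qed.
Lemma d1_1 : d1 (1 : P) = 0. Proof. exact: d1C. Qed.
Lemma d2_1 : d2 (1 : P) = 0. Proof. exact: d2CC. Qed.
Lemma d1_0 : d1 (0 : P) = 0. Proof. exact: d1C. Qed.
Lemma d2_0 : d2 (0 : P) = 0. Proof. by rewrite d2C deriv0. Qed.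

Definition dE := (d1D, d1N, d1M, d1CC, d1X, d1Y, d1_1, d1_0,
  d2D, d2N, d2M, d2CC, d2X, d2Y, d2_1, d2_0).

Lemma d1d2 p : d1 (d2 p) = d2 (d1 p).
Proof.
apply/polyP => i; rewrite coef_d2 /d1 !coef_deriv coef_d2.
by rewrite derivMn.
Qed.

Lemma div_curl p : div (curl p) = 0.
Proof. by rewrite /div /curl/= d1N d1d2 addNr. Qed.

Lemma curlD p q : curl (p + q) = curl p + curl q.
Proof. by rewrite /curl d1D d2D opprD. Qed.

Lemma evD p q z : ev (p + q) z = ev p z + ev q z.
Proof. by rewrite /ev !hornerD. Qed.

Lemma evN p z : ev (- p) z = - ev p z.
Proof. by rewrite /ev !hornerN. Qed.

Lemma evM p q z : ev (p * q) z = ev p z * ev q z.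
Proof. by rewrite /ev !hornerM. Qed.

Lemma evCC (c : R) z : ev c%:P%:P z = c.
Proof. by rewrite /ev !hornerC. Qed.

Lemma evX z : ev 'X z = z.1.
Proof. by rewrite /ev hornerX hornerC. Qed.

Lemma evY z : ev 'Y z = z.2.
Proof. by rewrite /ev hornerC hornerX. Qed.

Lemma ev1 z : ev 1 z = 1. Proof. exact: evCC. Qed.
Lemma ev0 z : ev 0 z = 0. Proof. exact: evCC. Qed.

Definition evE := (evD, evN, evM, evCC, evX, evY, ev1, ev0).

Lemma totdeg_leD r p q :
  totdeg_le r p -> totdeg_le r q -> totdeg_le r (p + q).
Proof.
move=> hp hq i j; rewrite coefD coefD.
have [->|/hp//] := eqVneq (p`_i)`_j 0.
by rewrite add0r => /hq.
Qed.

Lemma totdeg_le_mono r (c : R) i j : (i + j <= r)%N ->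
  totdeg_le r (c%:P%:P * mono i j).
Proof.
move=> ijr i' j'; rewrite /mono -rmorphXn/= mulrA mulrAC -rmorphM/= coefCM.
rewrite coefXn; have [->|] := eqVneq i' i; last by rewrite mulr0 coef0 eqxx.
rewrite mulr1 coefCM coefXn; have [->//|] := eqVneq j' j.
by rewrite mulr0 eqxx.
Qed.

Lemma totdeg_le_sum r p : totdeg_le r p ->
  p = \sum_(i < r.+1) \sum_(j < r.+1 | (i + j <= r)%N) (p`_i`_j)%:P%:P * mono i j.
Proof.
move=> hp; apply/polyP => k; apply/polyP => l.
rewrite coef_sum coef_sum.
transitivity (\sum_(i < r.+1) \sum_(j < r.+1 | (i + j <= r)%N)
    (if (k == i) && (l == j) then p`_i`_j else 0)); last first.
  apply: eq_bigr => i _; rewrite !coef_sum; apply: eq_bigr => j _.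
  rewrite /mono -rmorphXn/= mulrA mulrAC -rmorphM/= coefCM coefXn.
  have [_|_] := eqVneq k i; last by rewrite mulr0 coef0.
  rewrite mulr1 coefCM coefXn; have [_|_] := eqVneq l j; last by rewrite mulr0.
  by rewrite mulr1.
have [p0|pn0] := eqVneq (p`_k)`_l 0.
  rewrite p0 big1// => i _; rewrite big1// => j _.
  by have [<-|//] := eqVneq k i; have [<-|//] := eqVneq l j.
have klr := hp _ _ pn0.
have kr : (k < r.+1)%N by rewrite ltnS (leq_trans _ klr)// leq_addr.
have lr : (l < r.+1)%N by rewrite ltnS (leq_trans _ klr)// leq_addl.
rewrite (bigD1 (Ordinal kr))//= [X in _ + X]big1 ?addr0; last first.
  move=> i ik; rewrite big1// => j _; case: eqVneq => // ki.
  by move: ik; rewrite -(inj_eq val_inj)/= ki eqxx.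
rewrite (bigD1 (Ordinal lr))//= big1 ?addr0 ?eqxx//.
move=> j /andP[_ jl]; case: (l =P j) => //= lj.
by move: jl; rewrite -(inj_eq val_inj)/= lj eqxx.
Qed.

End BivariatePolynomials.

(** * Explicit coefficient forms of the shape functions *)

Section ShapeFunctions.
Variable R : realType.
Local Notation P := {poly {poly R}}.
Local Notation "c %:PP" := (c%:P%:P : P) (at level 2, format "c %:PP").
Implicit Types (p q : P) (a : nat -> R).

(** Coefficients are indexed by [nat] so that [nth] of a list can supply them; the indices 10 and 11
    carry the enrichment of the cubics. *)
Definition adini_poly a : P :=
  (a 0)%:PP + (a 1)%:PP * 'X + (a 2)%:PP * 'Y +
  (a 3)%:PP * 'X ^+ 2 + (a 4)%:PP * ('X * 'Y) + (a 5)%:PP * 'Y ^+ 2 +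
  (a 6)%:PP * 'X ^+ 3 + (a 7)%:PP * ('X ^+ 2 * 'Y) +
  (a 8)%:PP * ('X * 'Y ^+ 2) + (a 9)%:PP * 'Y ^+ 3 +
  (a 10)%:PP * ('X ^+ 3 * 'Y) + (a 11)%:PP * ('X * 'Y ^+ 3).

Lemma d1_adini a : d1 (adini_poly a) =
  (a 1)%:PP + (a 3 *+ 2)%:PP * 'X + (a 4)%:PP * 'Y + (a 6 *+ 3)%:PP * 'X ^+ 2 +
  (a 7 *+ 2)%:PP * ('X * 'Y) + (a 8)%:PP * 'Y ^+ 2 +
  (a 10 *+ 3)%:PP * ('X ^+ 2 * 'Y) + (a 11)%:PP * 'Y ^+ 3.
Proof. by rewrite /adini_poly !exprS !expr0 !dE; ring. Qed.

Lemma d2_adini a : d2 (adini_poly a) =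
  (a 2)%:PP + (a 4)%:PP * 'X + (a 5 *+ 2)%:PP * 'Y + (a 7)%:PP * 'X ^+ 2 +
  (a 8 *+ 2)%:PP * ('X * 'Y) + (a 9 *+ 3)%:PP * 'Y ^+ 2 +
  (a 10)%:PP * 'X ^+ 3 + (a 11 *+ 3)%:PP * ('X * 'Y ^+ 2).
Proof. by rewrite /adini_poly !exprS !expr0 !dE; ring. Qed.

Lemma adini_polyD a b : adini_poly a + adini_poly b = adini_poly (a \+ b).
Proof. by rewrite /adini_poly /=; ring. Qed.

Lemma totdeg_le_C r (c : R) : totdeg_le r c%:PP.
Proof.
have -> : c%:PP = c%:PP * mono R 0 0 by rewrite /mono !expr0 !mulr1.
exact: totdeg_le_mono.
Qed.

Lemma adini_shapeP p : adini_shape p <-> exists a, p = adini_poly a.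
Proof.
split=> [[q hq [_ [c ->] <-]]|[a ->]].
  rewrite (totdeg_le_sum hq); pose e i j := (q`_i)`_j.
  exists (nth 0 [:: e 0 0; e 1 0; e 0 1; e 2 0; e 1 1; e 0 2; e 3 0; e 2 1;
     e 1 2; e 0 3; c 0; c 1]%N).
  under eq_bigr do rewrite big_mkcond.
  rewrite !big_ord_recl !big_ord0 /= /mono /adini_poly /e /bump /=.
  by rewrite !big_ord_recl big_ord0 /= -!mul_polyC; ring.
pose b := [eta a with 10%N |-> 0, 11%N |-> 0].
exists (adini_poly b).
  have -> : adini_poly b =
    (a 0)%:PP * mono R 0 0 + (a 1)%:PP * mono R 1 0 + (a 2)%:PP * mono R 0 1 +
    (a 3)%:PP * mono R 2 0 + (a 4)%:PP * mono R 1 1 + (a 5)%:PP * mono R 0 2 +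
    (a 6)%:PP * mono R 3 0 + (a 7)%:PP * mono R 2 1 + (a 8)%:PP * mono R 1 2 +
    (a 9)%:PP * mono R 0 3.
    by rewrite /adini_poly /b /mono /=; ring.
  by do !apply: totdeg_leD; apply: totdeg_le_mono.
exists (\sum_(i < 2) (a (10 + i)%N)%:P *: [:: 'X^3 * 'Y; 'X * 'Y ^+ 3]`_i).
  by exists (fun i => a (10 + i)%N).
by rewrite !big_ord_recl big_ord0 /adini_poly /b /bump /= -!mul_polyC; ring.
Qed.

Lemma curlZ (c : R) p : curl (c%:PP * p) = c%:P *: curl p.
Proof.
by rewrite /curl d1M d2M d1CC d2CC !mul0r !add0r !mul_polyC -scalerN.
Qed.

Let curl_basis : seq (P * P) :=
  [:: curl 'X^3; curl ('Y ^+ 3); curl ('X^2 * 'Y); curl ('X * 'Y ^+ 2);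
      curl ('X^3 * 'Y); curl ('X * 'Y ^+ 3)].

Let sum_curl_basis (c : nat -> R) :
  \sum_(i < size curl_basis) (c i)%:P *: curl_basis`_i =
  curl ((c 0)%:PP * 'X^3 + (c 1)%:PP * 'Y ^+ 3 + (c 2)%:PP * ('X^2 * 'Y) +
    (c 3)%:PP * ('X * 'Y ^+ 2) + (c 4)%:PP * ('X^3 * 'Y) +
    (c 5)%:PP * ('X * 'Y ^+ 3)).
Proof. by rewrite !curlD !curlZ /= !big_ord_recr big_ord0 /= add0r. Qed.

(** Curls of polynomials of degree two fill the five-dimensional divergence-free part of the
    six-dimensional space of linear fields; [('X, 0)] supplies the missing dimension, so [c] is the
    divergence. *)
Lemma vector_shapeP (u : P * P) : vector_shape u <->
  exists p c, adini_shape p /\ u = curl p + (c%:PP * 'X, 0).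
Proof.
split=> [[[v1 v2] [/= hv1 hv2] [_ [c ->] <-]]|[p [c [/adini_shapeP[a ->] ->]]]].
  rewrite (totdeg_le_sum hv1) (totdeg_le_sum hv2) sum_curl_basis.
  pose e i j := (v1`_i)`_j; pose f i j := (v2`_i)`_j.
  (* Entries 1 to 5 integrate [v2] in x and the part of [v1] free of x in y. The x-coefficient of
     the first component then comes out as [- f 0 1] and is corrected by the divergence. *)
  pose a := nth 0 [:: 0%R; f 0 0; - e 0 0; f 1 0 / 2; f 0 1; - e 0 1 / 2; c 0; c 2;
    c 3; c 1; c 4; c 5]%N.
  exists (adini_poly a), (e 1%N 0%N + f 0%N 1%N); split.
    by apply/adini_shapeP; exists a.
  under eq_bigr do rewrite big_mkcond.
  under [X in (_, X)]eq_bigr do rewrite big_mkcond.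
  rewrite !big_ord_recl !big_ord0 /= /mono /bump /=.
  rewrite /curl d1_adini d2_adini /a /=.
  have -> : f 1%N 0%N / 2 *+ 2 = f 1%N 0%N by rewrite -mulr_natr divfK.
  have -> : - e 0%N 1%N / 2 *+ 2 = - e 0%N 1%N by rewrite -mulr_natr divfK.
  rewrite !exprS !expr0 !dE /e /f.
  by congr pair => /=; rewrite ?(big_ord_recl, big_ord0) /bump /=; ring.
exists (- (a 2)%:PP * mono R 0 0 + (c - a 4)%:PP * mono R 1 0 +
   (- a 5 *+ 2)%:PP * mono R 0 1,
   (a 1)%:PP * mono R 0 0 + (a 3 *+ 2)%:PP * mono R 1 0 + (a 4)%:PP * mono R 0 1).
  split; last by do !apply: totdeg_leD; exact: totdeg_le_mono.
  by rewrite -!rmorphN; do !apply: totdeg_leD; exact: totdeg_le_mono.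
pose b := nth 0 [:: a 6; a 9; a 7; a 8; a 10; a 11]%N.
exists (\sum_(i < size curl_basis) (b i)%:P *: curl_basis`_i); first by exists b.
rewrite sum_curl_basis /b /= /curl d1_adini d2_adini !exprS !expr0 !dE /mono /=.
by congr pair => /=; ring.
Qed.

End ShapeFunctions.

(** * Traces on edges and edge fluxes *)

Section Edges.
Variable R : realType.
Local Notation P := {poly {poly R}}.

Lemma integral_horner_deriv (r : {poly R}) (h : R) : 0 < h ->
  \int[lebesgue_measure]_(t in `[0, h]) (deriv r).[t] = r.[h] - r.[0].
Proof.
move=> h0; rewrite /Rintegral (@continuous_FTC2 _ _ (horner r))//.
- by apply: continuous_subspaceT => x; exact: continuous_horner.
- split=> [x _| |]; first exact: derivable_horner.
  + by apply: cvg_at_right_filter; exact: continuous_horner.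
  + by apply: cvg_at_left_filter; exact: continuous_horner.
- by move=> x _; rewrite -derivE.
Qed.

Lemma integral_quadratic (c1 c2 c3 h : R) : 0 < h ->
  \int[lebesgue_measure]_(t in `[0, h]) (c1 + 2 * c2 * t + 3 * c3 * t ^+ 2) =
  c1 * h + c2 * h ^+ 2 + c3 * h ^+ 3.
Proof.
move=> h0; pose r : {poly R} := c1%:P * 'X + c2%:P * 'X^2 + c3%:P * 'X^3.
under eq_Rintegral => t _.
  have -> : c1 + 2 * c2 * t + 3 * c3 * t ^+ 2 = (deriv r).[t].
    by rewrite /r !derivD !mul_polyC !derivZ !derivXn derivX !hornerE /=; ring.
  over.
by rewrite integral_horner_deriv// /r !hornerE /=; ring.
Qed.

Section Cell.
Variable T : square_family R.
Implicit Types (K L : T) (e f : bool * bool).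

Lemma edge_pointE K e t : edge_point K e t =
  if e.1 then ((corner K).1 + side K *+ e.2, (corner K).2 + t)
  else ((corner K).1 + t, (corner K).2 + side K *+ e.2).
Proof.
rewrite /edge_point /edge_normal /edge_tangent; case: e => -[] b /=;
  apply/eqP; rewrite xpair_eqE /= /GRing.scale /= !mulr1 !mulr0 !addr0;
  by rewrite !eqxx.
Qed.

Lemma vertexE K i :
  vertex K i = ((corner K).1 + side K *+ i.1, (corner K).2 + side K *+ i.2).
Proof. by []. Qed.

Lemma edge_point0 K e :
  edge_point K e 0 = vertex K (if e.1 then (e.2, false) else (false, e.2)).
Proof. by rewrite edge_pointE vertexE; case: e => -[] b /=; rewrite ?mulr0n. Qed.

Lemma edge_point_side K e :
  edge_point K e (side K) = vertex K (if e.1 then (e.2, true) else (true, e.2)).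
Proof. by rewrite edge_pointE vertexE; case: e => -[] b /=; rewrite ?mulr1n. Qed.

Lemma edgeP K e z : edge K e z <->
  if e.1 then z.1 = (corner K).1 + side K *+ e.2 /\
    (corner K).2 <= z.2 <= (corner K).2 + side K
  else z.2 = (corner K).2 + side K *+ e.2 /\
    (corner K).1 <= z.1 <= (corner K).1 + side K.
Proof.
split=> [[t /=]|].
  rewrite in_itv/= => /andP[t0 th] <-; rewrite edge_pointE.
  by case: e => -[] b /=; split=> //; apply/andP; split; lra.
case: z => x y; case: e => -[] b /= [-> /andP[h1 h2]].
- exists (y - (corner K).2); last by rewrite edge_pointE/=; congr pair; ring.
  by rewrite /= in_itv /=; apply/andP; split; lra.
- exists (x - (corner K).1); last by rewrite edge_pointE/=; congr pair; ring.
  by rewrite /= in_itv /=; apply/andP; split; lra.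
Qed.

(** Every edge is parametrized from its lower or left end, so its point set determines the
    parametrization. The flags [e.2] and [f.2] may differ: a shared edge can be upper for one square
    and lower for the other. *)
Lemma edge_inj K L e f : edge K e = edge L f ->
  [/\ e.1 = f.1, side K = side L & edge_point K e =1 edge_point L f].
Proof.
move=> KL; have hK := side_gt0 K; have hL := side_gt0 L.
have K0 : edge L f (edge_point K e 0).
  by rewrite -KL; exists 0 => //=; rewrite in_itv/= lexx ltW.
have K1 : edge L f (edge_point K e (side K)).
  by rewrite -KL; exists (side K) => //=; rewrite in_itv/= lexx ltW.
have L0 : edge K e (edge_point L f 0).
  by rewrite KL; exists 0 => //=; rewrite in_itv/= lexx ltW.
have L1 : edge K e (edge_point L f (side L)).
  by rewrite KL; exists (side L) => //=; rewrite in_itv/= lexx ltW.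
move: K0 K1 L0 L1 {KL}; rewrite !edgeP !edge_pointE; case: (e) (f) => -[] b [[] c]/=;
  move=> [K0 /andP[K0l K0r]] [K1 /andP[K1l K1r]] [L0 /andP[L0l L0r]]
    [L1 /andP[L1l L1r]]; try (exfalso; lra).
- split=> //; first lra.
  by move=> t; rewrite !edge_pointE/=; congr pair; lra.
- split=> //; first lra.
  by move=> t; rewrite !edge_pointE/=; congr pair; lra.
Qed.

Definition dtangent e : P -> P := if e.1 then @d2 R else @d1 R.

(** The normal of a vertical edge picks [- d2] out of a curl, that of a horizontal edge picks
    [d1]. *)
Definition flux_sign e : R := if e.1 then -1 else 1.

(** The enrichments x^3 y and x y^3 are still at most cubic in each variable separately. *)
Lemma adini_edge p K e : adini_shape p -> exists c0 c1 c2 c3 : R, forall t,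
  ev p (edge_point K e t) = c0 + c1 * t + c2 * t ^+ 2 + c3 * t ^+ 3 /\
  ev (dtangent e p) (edge_point K e t) = c1 + 2 * c2 * t + 3 * c3 * t ^+ 2.
Proof.
move=> /adini_shapeP[a ->]; pose z := edge_point K e 0.
exists (ev (adini_poly a) z), (ev (dtangent e (adini_poly a)) z).
exists (if e.1 then a 5 + a 8 * z.1 + 3 * a 9 * z.2 + 3 * a 11 * z.1 * z.2
        else a 3 + 3 * a 6 * z.1 + a 7 * z.2 + 3 * a 10 * z.1 * z.2).
exists (if e.1 then a 9 + a 11 * z.1 else a 6 + a 10 * z.2) => t.
rewrite /z /dtangent !edge_pointE.
case: e {z} => -[] b /=; rewrite ?d1_adini ?d2_adini /adini_poly.
- rewrite !exprS !expr0 !evE /=; split; ring.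
- rewrite !exprS !expr0 !evE /=; split; ring.
Qed.

(** The normal component of a curl is, up to sign, the tangential derivative of the potential, which
    integrates to a difference of end values. *)
Lemma edge_flux_curl p K e : adini_shape p ->
  edge_flux K e (curl p) = flux_sign e *
    (ev p (edge_point K e (side K)) - ev p (edge_point K e 0)).
Proof.
move=> pA; have [c0 [c1 [c2 [c3 pE]]]] := adini_edge K e pA.
rewrite (pE _).1 (pE 0).1 /edge_flux; set s := flux_sign e.
under eq_Rintegral => t _.
  have -> : ev (curl p).1 (edge_point K e t) * (edge_normal R e).1 +
      ev (curl p).2 (edge_point K e t) * (edge_normal R e).2 =
      s * c1 + 2 * (s * c2) * t + 3 * (s * c3) * t ^+ 2.
    have := (pE t).2; rewrite /dtangent /s /flux_sign /edge_normal.
    by case: e {pE s} => -[] b /=; rewrite ?evN => ->; ring.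
  over.
by rewrite integral_quadratic ?side_gt0//; ring.
Qed.

End Cell.
End Edges.

(** * The two inclusions and the surjectivity of the divergence *)

Section LocalComplex.
Variables (R : realType) (T : square_family R).
Local Notation P := {poly {poly R}}.
Local Notation "c %:PP" := (c%:P%:P : P) (at level 2, format "c %:PP").
Implicit Types (K L : T) (e f : bool * bool).

Lemma squareP K z : square K z <->
  (corner K).1 <= z.1 <= (corner K).1 + side K /\
  (corner K).2 <= z.2 <= (corner K).2 + side K.
Proof. by rewrite /square /= !in_itv. Qed.

Lemma vertex_square K i : square K (vertex K i).
Proof.
have h0 := side_gt0 K; apply/squareP; rewrite vertexE.
by case: i => -[] [] /=; split; apply/andP; split; lra.
Qed.

(** Rules out overlaps of positive area: one coordinate is constant on a common point or a common
    edge. *)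
Lemma conforming_overlap K L z w : conforming T -> K != L ->
  square K z -> square L z -> square K w -> square L w ->
  z.1 = w.1 \/ z.2 = w.2.
Proof.
move=> cT KL Kz Lz Kw Lw.
have zKL : (square K `&` square L) z by [].
have wKL : (square K `&` square L) w by [].
case: (cT _ _ KL) => [E|[i [j [_ E]]]|[e [f [_ E]]]]; move: zKL wKL; rewrite E.
- by [].
- by move=> -> ->; left.
- rewrite !edgeP; case: ifP => _ [-> _] [-> _]; [by left|by right].
Qed.

(** Otherwise the overlap contains a rectangle whose opposite corners differ in both coordinates. *)
Lemma conforming_column K L : conforming T ->
  (corner K).2 = (corner L).2 -> side K = side L ->
  (corner K).1 <= (corner L).1 < (corner K).1 + side K -> K = L.
Proof.
move=> cT y h /andP[l r]; apply/eqP/negPn/negP => KL.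
have h0 := side_gt0 K.
have inKL x y' : (corner L).1 <= x <= (corner K).1 + side K ->
    (corner K).2 <= y' <= (corner K).2 + side K ->
    square K (x, y') /\ square L (x, y').
  move=> /andP[? ?] /andP[? ?]; rewrite !squareP/=.
  by split; split; apply/andP; split; lra.
have [||Kz Lz] := inKL (corner L).1 (corner L).2.
- by apply/andP; split; lra.
- by apply/andP; split; lra.
have [||Kw Lw] := inKL ((corner K).1 + side K) ((corner K).2 + side K).
- by apply/andP; split; lra.
- by apply/andP; split; lra.
by have [/=|/=] := conforming_overlap cT KL Kz Lz Kw Lw; lra.
Qed.

Lemma vector_shape_curl (p : P) : adini_shape p -> vector_shape (curl p).
Proof.
move=> pA; apply/vector_shapeP; exists p, 0; split=> //.
by rewrite mul0r -[curl p in LHS]addr0.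
Qed.

(** Vertex values of the curl are, up to sign, derivative degrees of freedom of the potential, and
    its fluxes are differences of vertex values. *)
Lemma curl_A3_sub_A2 : (@curl_h R T) @` (@A3Lambda0 R T) `<=` @A2Lambda1 R T.
Proof.
move=> _ [u [uA uV] <-]; split.
- by move=> K; rewrite ffunE; exact: vector_shape_curl.
- move=> K L i j ij; have := uV K L i j ij; rewrite !ffunE /=.
  by move=> [_ e1 e2]; rewrite !evN e1 e2.
- move=> K L e f ef; have [ef1 hKL eKL] := edge_inj ef.
  rewrite !ffunE !edge_flux_curl// /flux_sign ef1; congr (_ * _).
  have end0 : edge_point K e 0 = edge_point L f 0 by [].
  have end1 : edge_point K e (side K) = edge_point L f (side L).
    by rewrite eKL hKL.
  move: end0 end1; rewrite !edge_point0 !edge_point_side.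
  by move=> /(uV K L)[-> _ _] /(uV K L)[-> _ _].
Qed.

Lemma div_vector_shape (p : P) (c : R) : div (curl p + (c%:PP * 'X, 0)) = c%:PP.
Proof.
transitivity (div (curl p) + c%:PP); last by rewrite div_curl add0r.
by rewrite /div /= !d1D !d2D d1M d1CC d1X d2_0; ring.
Qed.

Lemma div_A2_sub_A1 : (@div_h R T) @` (@A2Lambda1 R T) `<=` @A1Lambda2 R T.
Proof.
move=> _ [u [uS _ _] <-] K; have /vector_shapeP[p [c [_ uE]]] := uS K.
by rewrite ffunE uE div_vector_shape; exact: totdeg_le_C.
Qed.

Lemma totdeg0P (p : P) : totdeg_le 0 p -> p = (p`_0`_0)%:PP.
Proof.
move/totdeg_le_sum => {1}->; rewrite big_mkcond /= big_ord1 /=.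
by rewrite big_mkcond /= big_ord1 /= /mono !mulr1.
Qed.

(** * A field with prescribed divergence, built row by row *)

Section DivOnto.
Variable c : T -> R.

(* The prescribed total flux through the vertical edge of length [h] with
   lower end [(x, y)]: everything produced in the row to its left. *)
Definition row_flux (x y h : R) : R :=
  \sum_(L : T | [&& (corner L).2 == y, side L == h & (corner L).1 < x])
    c L * h ^+ 2.

(** By [conforming_column], [K] is the only square of its row and size with its corner at or beyond
    the left edge of [K] but before the right one. *)
Lemma row_flux_step K : conforming T ->
  row_flux ((corner K).1 + side K) (corner K).2 (side K) =
  row_flux (corner K).1 (corner K).2 (side K) + c K * side K ^+ 2.
Proof.
move=> cT; rewrite /row_flux (bigD1 K)/=; last first.
  by rewrite !eqxx/= ltrDl side_gt0.
rewrite addrC; congr (_ + _); apply: eq_bigl => L.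
have [y|//] := eqVneq (corner L).2 (corner K).2.
have [h|//] := eqVneq (side L) (side K).
have [->|LK] := eqVneq L K; first by rewrite andbF ltxx.
rewrite !andTb andbT; apply/idP/idP => [xL|/lt_trans]; last first.
  by apply; rewrite ltrDl side_gt0.
rewrite ltNge; apply: contra LK => xLK; apply/eqP/esym.
by apply: conforming_column => //; rewrite xLK xL.
Qed.

Let al K := row_flux (corner K).1 (corner K).2 (side K).

Let h2 K : side K != 0. Proof. by rewrite gt_eqF ?side_gt0. Qed.

(* With [X] and [Y] the coordinates relative to the corner and [h] the side,
   these are the coefficients of [c X Y - 3 c X Y^2 / h + 2 c X Y^3 / h^2
   - 3 al Y^2 / h^2 + 2 al Y^3 / h^3 + c (corner K).1 y].  Adding [(c x, 0)] to
   the curl gives a field that vanishes at the vertices, has no flux through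
   the horizontal edges and flux [al], [al + c h^2] through the vertical ones. *)
Definition row_stream K : nat -> R :=
  let x := (corner K).1 in let y := (corner K).2 in
  let A := c K in let B := - 3 * c K / side K in
  let C := 2 * c K / side K ^+ 2 in let D := - 3 * al K / side K ^+ 2 in
  let E := 2 * al K / side K ^+ 3 in
  nth 0 [:: A * x * y - B * x * y ^+ 2 + C * x * y ^+ 3 + D * y ^+ 2 - E * y ^+ 3;
    - A * y + B * y ^+ 2 - C * y ^+ 3;
    - A * x + 2 * B * x * y - 3 * C * x * y ^+ 2 - 2 * D * y + 3 * E * y ^+ 2
      + c K * x;
    0;
    A - 2 * B * y + 3 * C * y ^+ 2;
    - B * x + 3 * C * x * y + D - 3 * E * y;
    0; 0;
    B - 3 * C * y;
    - C * x + E;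
    0; C].

Definition row_field K : P * P :=
  curl (adini_poly (row_stream K)) + ((c K)%:PP * 'X, 0).

Lemma row_field1 K z :
  ev (row_field K).1 z =
  6 * ((z.2 - (corner K).2) - (z.2 - (corner K).2) ^+ 2 / side K) *
  (c K * (z.1 - (corner K).1) / side K + al K / side K ^+ 2).
Proof.
rewrite /row_field /curl /= d2_adini /row_stream /= !exprS !expr0 !evE.
have := h2 K; move: (al K) (c K) (side K) (corner K) z => a c0 h [x0 y0] [x y]/=.
by move=> h0; field.
Qed.

Lemma row_field2 K z :
  ev (row_field K).2 z = c K * (z.2 - (corner K).2) *
  (1 - (z.2 - (corner K).2) / side K) * (1 - 2 * (z.2 - (corner K).2) / side K).
Proof.
rewrite /row_field /curl /= addr0 d1_adini /row_stream /= !exprS !expr0 !evE.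
have := h2 K; move: (al K) (c K) (side K) (corner K) z => a c0 h [x0 y0] [x y]/=.
by move=> h0; field.
Qed.

Lemma row_field_vertex K i :
  ev (row_field K).1 (vertex K i) = 0 /\ ev (row_field K).2 (vertex K i) = 0.
Proof.
rewrite row_field1 row_field2 vertexE /= !(addrC (corner K).1) !(addrC (corner K).2) !addrK.
have := h2 K; case: i => b [] /= h0; rewrite ?mulr0n ?mulr1n; split; by field.
Qed.

Lemma edge_flux_row_field K e : conforming T ->
  edge_flux K e (row_field K) =
  if e.1 then row_flux (edge_point K e 0).1 (edge_point K e 0).2 (side K) else 0.
Proof.
move=> cT; have h0 := h2 K.
(* With h the side, the normal component on a vertical edge is 6 k (t - t^2 / h), of integral k h^2;
   on a horizontal edge it vanishes. *)
pose k := c K * (side K *+ e.2) / side K + al K / side K ^+ 2.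
pose s : R := if e.1 then 6 * k else 0.
rewrite /edge_flux; under eq_Rintegral => t _.
  have -> : ev (row_field K).1 (edge_point K e t) * (edge_normal R e).1 +
      ev (row_field K).2 (edge_point K e t) * (edge_normal R e).2 =
      0 + 2 * (s / 2) * t + 3 * (- s / (3 * side K)) * t ^+ 2.
    rewrite row_field1 row_field2 /s /edge_normal edge_pointE /k.
    rewrite !(addrC (corner K).1) !(addrC (corner K).2).
    case: e {k s} => -[] b /=; rewrite !addrK; first by field.
    by case: b => /=; rewrite ?mulr0n ?mulr1n; field.
  over.
rewrite integral_quadratic ?side_gt0// /s /k edge_pointE.
case: e {k s} => -[] b /=; last by field.
rewrite addr0; transitivity (c K * side K * (side K *+ b) + al K); first by field.
rewrite /al; case: b; rewrite ?mulr1n ?mulr0n ?mulr0 ?addr0 ?add0r//.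
by rewrite row_flux_step// addrC -mulrA -expr2.
Qed.

End DivOnto.

(** All vertex values of the row fields being zero, only fluxes have to match, and these depend on
    the edge alone, through its first end and its length. The final zero map expresses
    surjectivity. *)
Lemma div_onto : conforming T ->
  exact_at (@A2Lambda1 R T) (@div_h R T) (@A1Lambda2 R T) (fun=> 0 : R).
Proof.
move=> cT; apply/seteqP; split.
  by move=> w ws; split=> //; exact: div_A2_sub_A1.
move=> w [wA _]; pose c K := ((w K)`_0)`_0.
exists [ffun K => row_field c K]; last first.
  by apply/ffunP => K; rewrite !ffunE div_vector_shape -totdeg0P.
split.
- move=> K; rewrite ffunE; apply/vector_shapeP.
  exists (adini_poly (row_stream c K)), (c K); split=> //.
  by apply/adini_shapeP; exists (row_stream c K).
- move=> K L i j _; rewrite !ffunE.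
  by have [-> ->] := row_field_vertex c K i; have [-> ->] := row_field_vertex c L j.
- move=> K L e f /edge_inj[ef h efE].
  by rewrite !ffunE !edge_flux_row_field// ef h efE.
Qed.

End LocalComplex.

(** * Local potentials and their differences on intersections *)

Section Potentials.
Variables (R : realType) (T : square_family R).
Local Notation P := {poly {poly R}}.
Local Notation "c %:PP" := (c%:P%:P : P) (at level 2, format "c %:PP").
Implicit Types (K L : T) (e f : bool * bool).

Lemma curl_eq0 (p : P) : curl p = 0 -> p = (p`_0`_0)%:PP.
Proof.
move=> [/eqP]; rewrite oppr_eq0 => /eqP p2 p1.
have pS i j : p`_i.+1`_j = 0.
  have := congr1 (fun q : P => q`_i`_j) p1.
  rewrite coef_deriv coefMn !coef0 => /eqP; rewrite mulrn_eq0 => /orP[//|].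
  by move/eqP.
have p0 j : p`_0`_j.+1 = 0.
  have := congr1 (fun q : P => q`_0`_j) p2.
  rewrite coef_d2 coef_deriv !coef0 => /eqP; rewrite mulrn_eq0 => /orP[//|].
  by move/eqP.
apply/polyP => -[|i]; apply/polyP => j; rewrite coefC /= ?pS ?coef0//.
by case: j => [|j]; rewrite coefC.
Qed.

(* On the edge, [p - q] is a cubic whose derivative vanishes at both ends and
   whose end values agree, hence a constant. *)
Lemma edge_diff_constant (p q : P) K L e f t :
  adini_shape p -> adini_shape q -> edge K e = edge L f ->
  (forall i j, vertex K i = vertex L j ->
     ev (d1 p) (vertex K i) = ev (d1 q) (vertex L j) /\
     ev (d2 p) (vertex K i) = ev (d2 q) (vertex L j)) ->
  edge_flux K e (curl p) = edge_flux L f (curl q) ->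
  ev p (edge_point K e t) - ev q (edge_point K e t) =
  ev p (edge_point K e 0) - ev q (edge_point K e 0).
Proof.
move=> pA qA ef pq; have [ef1 h efE] := edge_inj ef.
rewrite !edge_flux_curl// -h -!efE.
have [a0 [a1 [a2 [a3 pE]]]] := adini_edge K e pA.
have [b0 [b1 [b2 [b3]]]] := adini_edge L f qA.
rewrite (_ : @dtangent R f = @dtangent R e); last by rewrite /dtangent ef1.
rewrite (_ : flux_sign R f = flux_sign R e); last by rewrite /flux_sign ef1.
move=> qE0.
have qE s : ev q (edge_point K e s) = b0 + b1 * s + b2 * s ^+ 2 + b3 * s ^+ 3 /\
    ev (@dtangent R e q) (edge_point K e s) = b1 + 2 * b2 * s + 3 * b3 * s ^+ 2.
  by rewrite efE.
have tangential z i j : z = vertex K i -> z = vertex L j ->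
    ev (@dtangent R e p) z = ev (@dtangent R e q) z.
  move=> -> ij; have [e1 e2] := pq _ _ ij.
  by rewrite {2}ij /dtangent; case: ifP.
have := tangential _ _ _ (edge_point0 K e) (etrans (efE 0) (edge_point0 L f)).
have := tangential _ _ _ (edge_point_side K e)
  (etrans (efE _) (etrans (congr1 _ h) (edge_point_side L f))).
rewrite !(pE _).1 !(qE _).1 !(pE _).2 !(qE _).2 => eh e0 /mulfI-/(_ _) E.
have {}E : a0 + a1 * side K + a2 * side K ^+ 2 + a3 * side K ^+ 3 -
    (a0 + a1 * 0 + a2 * 0 ^+ 2 + a3 * 0 ^+ 3) =
    b0 + b1 * side K + b2 * side K ^+ 2 + b3 * side K ^+ 3 -
    (b0 + b1 * 0 + b2 * 0 ^+ 2 + b3 * 0 ^+ 3).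
  by apply: E; rewrite /flux_sign; case: ifP => _; rewrite ?oppr_eq0 oner_eq0.
have h0 : side K != 0 by rewrite gt_eqF ?side_gt0.
have ab1 : a1 = b1 by lra.
(* Derivative and value at the far end give a homogeneous linear system, with nonzero determinant,
   for the quadratic and cubic coefficients of the difference. *)
have ab23 : 2 * (a2 - b2) + 3 * (a3 - b3) * side K = 0.
  by apply: (mulfI h0); lra.
have ab23' : (a2 - b2) + (a3 - b3) * side K = 0.
  by apply: (mulfI (mulf_neq0 h0 h0)); rewrite ab1 in E; lra.
have ab3 : a3 - b3 = 0 by apply: (mulfI h0); lra.
have ab2 : a2 - b2 = 0 by rewrite ab3 in ab23; lra.
have -> : a3 = b3 by lra.
have -> : a2 = b2 by lra.
by rewrite ab1; ring.
Qed.

Section Cocycle.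
Variable p : {ffun T -> P}.
Hypotheses (pA : forall K, adini_shape (p K)) (cpA2 : A2Lambda1 (curl_h p)).

(** Two distinct meeting squares share a single vertex, where nothing is to be proved, or an edge,
    where [edge_diff_constant] applies. *)
Lemma potential_diff K L y z : conforming T ->
  square K y -> square L y -> square K z -> square L z ->
  ev (p K) y - ev (p L) y = ev (p K) z - ev (p L) z.
Proof.
move=> cT Ky Ly Kz Lz; have [->|KL] := eqVneq K L; first by rewrite !subrr.
have yKL : (square K `&` square L) y by [].
have zKL : (square K `&` square L) z by [].
have [_ pV pE] := cpA2.
case: (cT _ _ KL) => [E|[i [j [_ E]]]|[e [f [ef E]]]]; move: yKL zKL; rewrite E.
- by [].
- by move=> -> ->.
- have pV' i j : vertex K i = vertex L j ->
     ev (d1 (p K)) (vertex K i) = ev (d1 (p L)) (vertex L j) /\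
     ev (d2 (p K)) (vertex K i) = ev (d2 (p L)) (vertex L j).
    move=> ij; have := pV K L i j ij; rewrite !ffunE /= !evN.
    by move=> [/oppr_inj].
  have := pE K L e f ef; rewrite !ffunE => pE'.
  move=> [s _ <-] [t _ <-].
  rewrite (edge_diff_constant s (pA K) (pA L) ef pV' pE').
  by rewrite (edge_diff_constant t (pA K) (pA L) ef pV' pE').
Qed.

End Cocycle.
End Potentials.

(** * Potentials of cocycles on contractible sets *)

Section Contractible.
Variable R : realType.

(** The Heine-Cantor theorem for relative continuity, from the near-covering form of compactness. *)
Lemma compact_within_unif_continuous (V W : normedModType R) (f : V -> W)
    (A : set V) (e : R) :
  compact A -> {within A, continuous f} -> 0 < e ->
  exists2 d : R, 0 < d &
    forall p q, A p -> A q -> `|p - q| < d -> `|f p - f q| < e.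
Proof.
move=> cA cf e0.
pose P (d : R) p := forall q, A p -> A q -> `|p - q| < d -> `|f p - f q| < e.
have cov : near_covering A by apply/compact_near_coveringP.
have near0 x : A x -> \forall x' \near x & d \near (0 : R)^'+, P d x'.
  move=> Ax; have /subspace_continuousP/(_ x Ax)/cvgrPdist_lt/(_ (e / 2)) := cf.
  move=> /(_ ltac:(lra)); rewrite near_withinE => /nbhs_ballP[r /= r0 fx0].
  have fx y : A y -> `|x - y| < r -> `|f x - f y| < e / 2.
    by move=> Ay xy; apply: fx0 => //; rewrite -ball_normE.
  (* Half of [r] for the point and half for [d] keep [q] within [r] of [x]. *)
  exists (ball x (r / 2), [set d | 0 < d < r / 2]) => /=.
    split; first by apply: nbhsx_ballx; rewrite divr_gt0.
    near=> d; apply/andP; split; near: d; first exact: nbhs_right_gt.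
    by apply: nbhs_right_lt; rewrite divr_gt0.
  move=> [y d] [/= xy /andP[d0 dr]] q Ay Aq yq.
  rewrite -ball_normE /= in xy.
  have h1 : `|f x - f y| < e / 2.
    by apply: fx => //=; apply: lt_trans xy _; rewrite ltr_pdivrMr// ltr_pMr// ltr1n.
  have h2 : `|f x - f q| < e / 2.
    apply: fx => //=; have -> : x - q = (x - y) + (y - q) by rewrite addrA subrK.
    rewrite (le_lt_trans (ler_normD _ _))//; have := lt_trans yq dr; lra.
  have -> : f y - f q = (f x - f q) - (f x - f y) by rewrite opprB [RHS]addrC addrA subrK.
  rewrite (le_lt_trans (ler_normB _ _))//; lra.
have dP : \forall d \near (0 : R)^'+, A `<=` P d by exact: cov.
have : exists d, 0 < d /\ A `<=` P d.
  apply: (@filter_ex _ (0 : R)^'+); apply: filterI => //; exact: nbhs_right_gt.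
move=> [d [d0 AP]]; exists d => // p q Ap Aq; exact: AP.
Unshelve. all: by end_near. Qed.

(* [g] is a cocycle on pairs of nearby points; its coboundary is obtained by
   summing [g] along the trajectory of the contraction, sampled with a step
   small enough that consecutive quadrilaterals are small. *)
Lemma contractible_potential (D C : set (R * R)) (g : R * R -> R * R -> R) (e : R) :
  contractible D -> compact C -> C `<=` D -> 0 < e ->
  (forall x y z, D x -> D y -> D z ->
    `|x - y| < e -> `|y - z| < e -> `|x - z| < e -> g x y + g y z = g x z) ->
  exists phi : R * R -> R, exists2 d, 0 < d &
    forall x y, C x -> C y -> `|x - y| < d -> g x y = phi y - phi x.
Proof.
move=> [z0 Dz0 [H [cH HD H0 H1]]] cC CD e0 gD.
pose A : set ((R * R) * R) := C `*` `[0, 1].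
have cA : compact A by apply: compact_setX => //; exact: segment_compact.
have AH : {within A, continuous H}.
  by apply: continuous_subspaceW cH => -[x t] [/= Cx t01]; split=> //=; exact: CD.
have [d d0 Hd] := compact_within_unif_continuous cA AH e0.
have [N Nd] : exists N : nat, N.+1%:R^-1 < d.
  have := near_infty_natSinv_lt (PosNum d0); case=> N _ /(_ N (leqnn _)) ?.
  by exists N.
pose s k : R := k%:R / N.+1%:R.
have N0 : 0 < N.+1%:R :> R by rewrite ltr0n.
have s01 k : (k <= N.+1)%N -> s k \in `[0, 1].
  by move=> kN; rewrite in_itv /= divr_ge0//= ler_pdivrMr// mul1r ler_nat.
have sS k : s k.+1 - s k = N.+1%:R^-1.
  by rewrite /s -mulrBl -natrB// subSnn mul1r.
(* The trajectory is traversed backwards, from [z0] at time 1 to [z] at time 0. *)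
pose phi z := \sum_(k < N.+1) g (H (z, s k.+1)) (H (z, s k)).
exists phi, d => // x y Cx Cy xy; rewrite -sumrB.
pose G k := g (H (x, s k)) (H (y, s k)).
have DH z k : C z -> (k <= N.+1)%N -> D (H (z, s k)).
  by move=> Cz kN; apply: HD; [exact: CD|exact: s01].
have near z w k l : C z -> C w -> (k <= N.+1)%N -> (l <= N.+1)%N ->
    `|z - w| < d -> `|s k - s l| < d -> `|H (z, s k) - H (w, s l)| < e.
  move=> Cz Cw kN lN zw kl; apply: Hd; [by split=> //=; exact: s01..|].
  by rewrite prod_normE /= gt_max zw kl.
have self (z : R) : `|z - z| < d by rewrite subrr normr0.
have self1 (z : R * R) : `|z - z| < d by rewrite subrr normr0.
have sS1 k : `|s k.+1 - s k| < d by rewrite sS ger0_norm// invr_ge0 ltW.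
(* This telescopes to [g x y - g z0 z0], and the cocycle identity forces [g z0 z0 = 0]. *)
transitivity (\sum_(k < N.+1) (G k - G k.+1)).
  rewrite -(big_mkord predT (fun k => G k - G k.+1)).
  under eq_bigr do rewrite -opprB.
  rewrite sumrN telescope_sumr// opprB /G /s mul0r divff ?gt_eqF//.
  rewrite !H0 ?H1; [|exact: CD..].
  have := gD z0 z0 z0; rewrite subrr normr0 e0 => /(_ Dz0 Dz0 Dz0 isT isT isT).
  move=> /eqP; rewrite -subr_eq0 addrK => /eqP ->; by rewrite subr0.
apply: eq_bigr => k _; have kN := ltn_ord k; have kN' := ltnW kN.
(* The diagonal from [H (x, s k.+1)] to [H (y, s k)] cuts the quadrilateral of consecutive samples
   into two triangles. *)
have t1 := gD _ _ _ (DH x k.+1 Cx kN) (DH x k Cx kN') (DH y k Cy kN')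
  (near _ _ _ _ Cx Cx kN kN' (self1 x) (sS1 k)) (near _ _ _ _ Cx Cy kN' kN' xy (self _))
  (near _ _ _ _ Cx Cy kN kN' xy (sS1 k)).
have t2 := gD _ _ _ (DH x k.+1 Cx kN) (DH y k.+1 Cy kN) (DH y k Cy kN')
  (near _ _ _ _ Cx Cy kN kN xy (self _)) (near _ _ _ _ Cy Cy kN kN' (self1 y) (sS1 k))
  (near _ _ _ _ Cx Cy kN kN' xy (sS1 k)).
rewrite /G; lra.
Qed.

End Contractible.

(** * Discrete connection along paths *)

Section Paths.
Variable R : realType.
Implicit Types (S D : set (R * R)) (v w z : R * R).

(* A combinatorial substitute for being joined by a path in [S]. *)
Definition linked S z w := forall (f : R * R -> R) d, 0 < d ->
  (forall x y, S x -> S y -> `|x - y| < d -> f x = f y) -> f z = f w.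

(** The compact carrier is recorded because [contractible_potential] yields a function only on a
    compact subset. *)
Definition joined S z w :=
  exists2 A, compact A /\ A `<=` S & linked A z w.

Lemma sub_linked S S' z w : S `<=` S' -> linked S z w -> linked S' z w.
Proof.
by move=> SS' Szw f d d0 fd; apply: (Szw f d d0) => x y /SS' ? /SS' ?; exact: fd.
Qed.

Lemma sub_joined S S' z w : S `<=` S' -> joined S z w -> joined S' z w.
Proof. by move=> SS' [A [cA AS] zw]; exists A => //; split=> // x /AS/SS'. Qed.

Lemma joined_trans S z w v : joined S z w -> joined S w v -> joined S z v.
Proof.
move=> [A [cA AS] Azw] [B [cB BS] Bwv]; exists (A `|` B).
  by split; [exact: compactU|rewrite subUset].
move=> f d d0 fd.
rewrite (sub_linked (@subsetUl _ A B) Azw d0 fd).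
exact: (sub_linked (@subsetUr _ A B) Bwv d0 fd).
Qed.

Lemma joined_sym S z w : joined S z w -> joined S w z.
Proof.
by move=> [A cAS zw]; exists A => // f d d0 fd; rewrite (zw f d d0 fd).
Qed.

Lemma segment_continuous z w :
  continuous (fun t : R => (1 - t) *: z + t *: w).
Proof.
move=> t; apply: cvgD; apply: cvgZr_tmp; last exact: cvg_id.
by apply: cvgB; [exact: cvg_cst|exact: cvg_id].
Qed.

Lemma joined_segment S z w : segment (z, w) `<=` S -> joined S z w.
Proof.
move=> zwS; exists (segment (z, w)).
  split=> //; apply: continuous_compact; last exact: segment_compact.
  by apply: continuous_subspaceT => t; exact: segment_continuous.
move=> f d d0 fd.
have [N Nd] : exists N : nat, `|w - z| / N.+1%:R < d.
  have [w0|w0] := eqVneq `|w - z| 0; first by exists 0%N; rewrite w0 mul0r.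
  have w1 : 0 < `|w - z| by rewrite lt_neqAle eq_sym w0 normr_ge0.
  have := near_infty_natSinv_lt (PosNum (divr_gt0 d0 w1)).
  case=> N _ /(_ N (leqnn _)) /= ?; exists N.
  by rewrite mulrC -ltr_pdivlMr.
have N0 : 0 < N.+1%:R :> R by rewrite ltr0n.
pose p k := (1 - k%:R / N.+1%:R) *: z + (k%:R / N.+1%:R) *: w.
have pS k : (k <= N.+1)%N -> segment (z, w) (p k).
  move=> kN; exists (k%:R / N.+1%:R) => //=.
  by rewrite in_itv /= divr_ge0//= ler_pdivrMr// mul1r ler_nat.
have fp k : (k <= N.+1)%N -> f (p k) = f z.
  elim: k => [_|k IHk kN]; first by rewrite /p mul0r subr0 scale1r scale0r addr0.
  rewrite -IHk 1?ltnW//; apply: fd; [exact: pS|by apply: pS; exact: ltnW|].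
  suff -> : p k.+1 - p k = N.+1%:R^-1 *: (w - z).
    by rewrite normrZ ger0_norm ?invr_ge0 ?ltW// mulrC.
  rewrite /p; have -> : k.+1%:R / N.+1%:R = k%:R / N.+1%:R + N.+1%:R^-1 :> R.
    by rewrite -natr1 mulrDl mul1r.
  move: (k%:R / _) => t; rewrite [- (_ *: _ + _)]opprD addrACA -!scaleNr -!scalerDl.
  rewrite scalerBr addrC -scaleNr; congr (_ *: _ + _ *: _); ring.
by rewrite -(fp N.+1)// /p divff ?gt_eqF// subrr scale0r scale1r add0r.
Qed.

End Paths.

(** * Local geometry of Lipschitz charts *)

Section LipschitzDomains.
Variable R : realType.
Implicit Types (D : set (R * R)) (v w z : R * R).

Lemma norm_pair_lt z (e : R) : (`|z| < e) = (`|z.1| < e) && (`|z.2| < e).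
Proof. by rewrite prod_normE gt_max. Qed.

Lemma segment_convex2 z w t : (1 - t) *: z + t *: w =
  ((1 - t) * z.1 + t * w.1, (1 - t) * z.2 + t * w.2).
Proof. by []. Qed.

Lemma klipschitzP (L : R) (phi : R -> R) : L.-lipschitz phi ->
  forall x y, `|phi x - phi y| <= L * `|x - y|.
Proof. by move=> hL x y; have := hL (x, y) (conj I I). Qed.

Variable (c s : R).
Hypothesis cs1 : c ^+ 2 + s ^+ 2 = 1.

Lemma unit_le1 : `|c| <= 1 /\ `|s| <= 1.
Proof.
by split; rewrite -(@ler_pXn2r _ 2) ?nnegrE// expr1n real_normK ?num_real//
  -cs1 (lerDl, lerDr) sqr_ge0.
Qed.

Let frame z (x y : R) : R * R := z + x *: (c, s) + y *: (- s, c).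

Lemma frameE z x y : frame z x y = (z.1 + x * c - y * s, z.2 + x * s + y * c).
Proof. by apply: injective_projections; rewrite /= /GRing.scale /=; ring. Qed.

Lemma norm_comb_le a b x y (e : R) : `|a| <= 1 -> `|b| <= 1 ->
  `|x| + `|y| < e -> `|x * a + y * b| < e.
Proof.
move=> a1 b1; apply: le_lt_trans; apply: le_trans (ler_normD _ _) _.
by rewrite !normrM lerD// ler_piMr.
Qed.

Lemma frame_near z x y e : `|x| + `|y| < e -> `|frame z x y - z| < e.
Proof.
have [c1 s1] := unit_le1.
move=> xye; rewrite frameE norm_pair_lt /=; apply/andP; split.
  have -> : z.1 + x * c - y * s - z.1 = x * c + y * (- s) by ring.
  by apply: norm_comb_le; rewrite ?normrN.
have -> : z.2 + x * s + y * c - z.2 = x * s + y * c by ring.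
exact: norm_comb_le.
Qed.

(** Chart coordinates are inner products with the orthonormal frame; as the norm is the maximum
    norm, they may double the bound. *)
Lemma frame_surj z w (e : R) : `|w - z| < e ->
  exists x y, [/\ w = frame z x y, `|x| < 2 * e & `|y| < 2 * e].
Proof.
have [c1 s1] := unit_le1.
rewrite norm_pair_lt /= => /andP[xe ye].
have xy2 : `|w.1 - z.1| + `|w.2 - z.2| < 2 * e by lra.
exists ((w.1 - z.1) * c + (w.2 - z.2) * s), ((w.1 - z.1) * - s + (w.2 - z.2) * c).
split; [|exact: norm_comb_le|by apply: norm_comb_le; rewrite ?normrN].
rewrite frameE; case: w z {xe ye xy2} => [w1 w2] [z1 z2] /=; congr pair.
  transitivity (z1 + (w1 - z1) * (c ^+ 2 + s ^+ 2)); last ring.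
  by rewrite cs1; ring.
transitivity (z2 + (w2 - z2) * (c ^+ 2 + s ^+ 2)); last ring.
by rewrite cs1; ring.
Qed.

Lemma frame_segment z x y x' y' (t : R) :
  (1 - t) *: frame z x y + t *: frame z x' y' =
  frame z ((1 - t) * x + t * x') ((1 - t) * y + t * y').
Proof. by rewrite !frameE segment_convex2 /=; congr pair; ring. Qed.

Variables (D : set (R * R)) (z : R * R) (r L : R) (phi : R -> R).
Hypotheses (r0 : 0 < r) (phiL : L.-lipschitz phi).
Hypothesis chart : forall xi eta : R, `|xi| < r -> `|eta| < r ->
  D (z + xi *: (c, s) + eta *: (- s, c)) <-> phi xi < eta.

Let phi_le x y : phi x <= phi y + `|L| * `|x - y|.
Proof.
have := klipschitzP phiL x y; rewrite ler_norml => /andP[_ h].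
have := ler_norm L; rewrite -subr_ge0 => h'.
have : 0 <= (`|L| - L) * `|x - y| by rewrite mulr_ge0.
lra.
Qed.

(** Here [phi 0] is nonnegative, so a point slightly below [z] in the chart has a whole ball below
    the graph, disjoint from [D]. *)
Lemma chart_not_interior (e : R) : 0 < e -> ~ D z ->
  (forall w, `|w - z| < e -> closure D w) -> False.
Proof.
move=> e0 nDz De.
have phi0 : 0 <= phi 0.
  rewrite leNgt; apply/negP => phi0; apply: nDz.
  have := @chart 0 0; rewrite normr0 !scale0r !addr0 => /(_ r0 r0) [_]; exact.
pose m := Num.min e r; have m0 : 0 < m by rewrite lt_min e0.
have [me mr] : m <= e /\ m <= r by rewrite !ge_min !lexx orbT.
have L0 := normr_ge0 L.
(* Within horizontal distance [2 * d] the graph falls by at most 2 |L| d, so a ball of radius [d] at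
   depth [a] = 4 (1 + |L|) d stays below it. *)
pose a := m / 2; pose d := a / (4 * (1 + `|L|)).
have a0 : 0 < a by rewrite /a; lra.
have d0 : 0 < d by rewrite divr_gt0//; lra.
have ad : a = 4 * d + 4 * (`|L| * d).
  by rewrite /d; field; rewrite gt_eqF//; lra.
have Ld : 0 <= `|L| * d by rewrite mulr_ge0// ltW.
have wz : `|frame z 0 (- a) - z| < e.
  by apply: frame_near; rewrite normr0 normrN gtr0_norm// /a; lra.
have [w' [Dw' ww']] : (D `&` ball (frame z 0 (- a)) d) !=set0.
  by apply: (De _ wz); exact: nbhsx_ballx.
move: ww'; rewrite -ball_normE /= distrC => /frame_surj[x [y [w'E xd yd]]].
have w'E' : w' = frame z x (y - a).
  by rewrite w'E !frameE /=; congr pair; ring.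
move: xd yd; rewrite !ltr_norml => /andP[xl xr] /andP[yl yr].
have xd : `|x| < 2 * d by rewrite ltr_norml xl xr.
move: Dw'; rewrite w'E' /frame chart; first last.
- by rewrite ltr_norml; apply/andP; split; rewrite /a in a0 ad *; lra.
- by apply: lt_le_trans xd _; rewrite /a in ad *; lra.
have := phi_le 0 x; rewrite sub0r normrN.
have : `|L| * `|x| <= `|L| * (2 * d) by rewrite ler_wpM2l// ltW.
lra.
Qed.

(* Two points close to the chart's centre are joined by going straight up from
   each of them to a common height above the graph of [phi]. *)
Lemma chart_joined (e : R) : 0 < e -> exists2 d, 0 < d &
  forall v w, D v -> D w -> `|v - z| < d -> `|w - z| < d ->
    joined (D `&` [set p | `|p - z| < e]) v w.
Proof.
move=> e0; pose m := Num.min e r; have m0 : 0 < m by rewrite lt_min e0.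
have [me mr] : m <= e /\ m <= r by rewrite !ge_min !lexx orbT.
have L0 := normr_ge0 L; have L1 : 0 < 3 + 2 * `|L| by lra.
pose a := m / (3 + 2 * `|L|); have a0 : 0 < a by rewrite divr_gt0.
have am : 3 * a + 2 * (`|L| * a) = m by rewrite /a; field; rewrite gt_eqF.
have La : 0 <= `|L| * a by rewrite mulr_ge0// ltW.
(* The height of [v] gives [phi x1 < a], hence [phi < h] at all abscissas below [a] in absolute
   value; [a + h < m] keeps the path in the chart and within [e] of [z]. *)
pose h := a + 2 * (`|L| * a).
exists (a / 2); first by lra.
move=> v w Dv Dw /frame_surj[x1 [y1 [v1 x1a y1a]]] /frame_surj[x2 [y2 [w2 x2a y2a]]].
rewrite {}v1 {}w2 in Dv Dw *.
have a2 : 2 * (a / 2) = a by field.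
rewrite a2 in x1a y1a x2a y2a.
have inD x y : `|x| < a -> phi x < y -> - a < y <= h ->
    (D `&` [set p | `|p - z| < e]) (frame z x y).
  move=> xa phixy /andP[ya yh].
  have yn : `|y| <= h by rewrite ler_norml yh andbT /h; lra.
  split; last by apply: frame_near; rewrite /h in yn; lra.
  by apply/chart => //; rewrite /h in yn; lra.
have low x y : `|x| < a -> `|y| < a -> D (frame z x y) -> phi x < y.
  by move=> xa ya /chart; apply; lra.
have {Dv} py1 := low _ _ x1a y1a Dv; have {Dw} py2 := low _ _ x2a y2a Dw.
have phih x : `|x| < a -> phi x < h.
  move=> xa; have := phi_le x x1; have : `|L| * `|x - x1| <= `|L| * (2 * a).
    by rewrite ler_wpM2l//; apply: le_trans (ler_normB _ _) _; lra.
  by move: y1a; rewrite ltr_norml /h => /andP[]; lra.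
have bnd y : `|y| < a -> - a < y < h.
  by rewrite ltr_norml /h => /andP[? ?]; apply/andP; split; lra.
have [y1l y1h] := andP (bnd _ y1a); have [y2l y2h] := andP (bnd _ y2a).
have vert x y t : `|x| < a -> phi x < y -> - a < y -> y < h -> 0 <= t <= 1 ->
    (D `&` [set p | `|p - z| < e]) (frame z x ((1 - t) * y + t * h)).
  move=> xa pxy ya yh /andP[t0 t1].
  have : 0 <= t * (h - y) by rewrite mulr_ge0//; lra.
  have : 0 <= (1 - t) * (h - y) by rewrite mulr_ge0//; lra.
  by move=> ? ?; apply: inD => //; [lra|apply/andP; split; lra].
apply: (@joined_trans _ _ _ (frame z x1 h)).
  apply: joined_segment => _ [t /= + <-]; rewrite in_itv/= => t01.
  by rewrite frame_segment -mulrDl subrK mul1r; exact: vert.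
apply: (@joined_trans _ _ _ (frame z x2 h)).
  apply: joined_segment => _ [t /= + <-]; rewrite in_itv/= => /andP[t0 t1].
  rewrite frame_segment -[_ * h + _]mulrDl subrK mul1r.
  have xa : `|(1 - t) * x1 + t * x2| < a.
    have [t00|t00] := eqVneq t 0; first by rewrite t00 subr0 mul1r mul0r addr0.
    have tp : 0 < t by rewrite lt_neqAle eq_sym t00.
    apply: le_lt_trans (ler_normD _ _) _; rewrite !normrM (ger0_norm t0) ger0_norm ?subr_ge0//.
    have : t * `|x2| < t * a by rewrite ltr_pM2l.
    have : (1 - t) * `|x1| <= (1 - t) * a by rewrite ler_wpM2l// ?subr_ge0// ltW.
    lra.
  by apply: inD => //; [exact: phih|rewrite lexx andbT /h; lra].
apply: joined_segment => _ [t /= + <-]; rewrite in_itv/= => /andP[t0 t1].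
rewrite frame_segment -[X in frame z X _]mulrDl subrK mul1r.
have -> : (1 - t) * h + t * y2 = (1 - (1 - t)) * y2 + (1 - t) * h by ring.
by apply: vert => //; apply/andP; split; lra.
Qed.

End LipschitzDomains.

(** * Intersections and distances of squares *)

Section MeshTopology.
Variables (R : realType) (T : square_family R).
Implicit Types (K L M : T) (z w v : R * R).

Definition meets K L := square K `&` square L !=set0.

Lemma meetsP K L : meets K L <->
  [/\ (corner K).1 <= (corner L).1 + side L, (corner L).1 <= (corner K).1 + side K,
      (corner K).2 <= (corner L).2 + side L & (corner L).2 <= (corner K).2 + side K].
Proof.
have hK := side_gt0 K; have hL := side_gt0 L; split.
  move=> [z [/squareP[/andP[? ?] /andP[? ?]] /squareP[/andP[? ?] /andP[? ?]]]].
  by split; lra.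
move=> [h1 h2 h3 h4].
exists (Num.max (corner K).1 (corner L).1, Num.max (corner K).2 (corner L).2).
split; apply/squareP => /=; rewrite !le_max !ge_max !lexx ?orbT /=;
  split; apply/andP; split; lra.
Qed.

Lemma square_meets K L z : square K z -> square L z -> meets K L.
Proof. by move=> ? ?; exists z. Qed.

(** In each coordinate, the largest left end of pairwise intersecting intervals lies in all of
    them. *)
Lemma helly K L M : meets K L -> meets L M -> meets K M ->
  exists z, [/\ square K z, square L z & square M z].
Proof.
have hK := side_gt0 K; have hL := side_gt0 L; have hM := side_gt0 M.
move=> /meetsP[? ? ? ?] /meetsP[? ? ? ?] /meetsP[? ? ? ?].
exists (Num.max (corner K).1 (Num.max (corner L).1 (corner M).1),
  Num.max (corner K).2 (Num.max (corner L).2 (corner M).2)).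
by split; apply/squareP => /=; rewrite !le_max !ge_max !lexx ?orbT /=;
  split; rewrite -?andbA; repeat (apply/andP; split); lra.
Qed.

Lemma finite_positive_bound (I : finType) (f : I -> R) : (forall i, 0 < f i) ->
  exists2 e, 0 < e & forall i, e <= f i.
Proof.
move=> f0; exists (\big[Num.min/1]_i f i).
  by apply: lt_bigmin => // i _.
by move=> i; exact: bigmin_le.
Qed.

(** There are finitely many pairs, so the distances between disjoint squares have a positive lower
    bound. *)
Lemma near_squares_meet : exists2 e : R, 0 < e & forall K L z w,
  square K z -> square L w -> `|z - w| < e -> meets K L.
Proof.
pose gap K L : R := Num.max
  (Num.max ((corner K).1 - (corner L).1 - side L) ((corner L).1 - (corner K).1 - side K))
  (Num.max ((corner K).2 - (corner L).2 - side L) ((corner L).2 - (corner K).2 - side K)).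
(* A positive [gap] is the distance in the maximum norm; meeting pairs get the dummy value 1. *)
have gap1 (p : T * T) : 0 < if 0 < gap p.1 p.2 then gap p.1 p.2 else 1.
  by case: ifP.
have [e e0 eP] := finite_positive_bound gap1.
exists e => // K L z w /squareP[/andP[? ?] /andP[? ?]] /squareP[/andP[? ?] /andP[? ?]] zw.
have gap_le : gap K L <= `|z - w|.
  have z1 : `|z.1 - w.1| <= `|z - w| by rewrite [X in _ <= X]prod_normE le_max lexx.
  have z2 : `|z.2 - w.2| <= `|z - w| by rewrite [X in _ <= X]prod_normE le_max lexx orbT.
  move: z1 z2; rewrite !ler_norml => /andP[? ?] /andP[? ?].
  by rewrite !ge_max; apply/andP; split; apply/andP; split; lra.
have : gap K L <= 0.
  rewrite leNgt; apply/negP => g0; have := eP (K, L); rewrite /= g0 => eg.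
  by have := lt_le_trans zw (le_trans eg gap_le); rewrite ltxx.
rewrite /gap !ge_max => /andP[/andP[? ?] /andP[? ?]].
by apply/meetsP; split; lra.
Qed.

End MeshTopology.

(** * Position of the squares relative to the domain *)

Section MeshedDomain.
Variables (R : realType) (T : square_family R) (D : set (R * R)).
Hypotheses (polyD : polygonal_domain D) (meshD : mesh_of T D).
Implicit Types (K L M : T) (z w v : R * R).

Lemma closure_square z : closure D z <-> exists K, square K z.
Proof.
have [-> _] := meshD; split=> [[K _ Kz]|[K Kz]]; first by exists K.
by exists K.
Qed.

Lemma square_boundary K z : square K z -> ~ D z -> boundary D z.
Proof.
move=> Kz nDz; split; first by apply/closure_square; exists K.
by move=> /interior_subset.
Qed.

Lemma square_closed K : closed (square K).
Proof.
apply: closedI; (apply: closed_comp; last exact: itv_closed) => x _;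
  [exact: cvg_fst|exact: cvg_snd].
Qed.

(** The squares with value [c K] and those with other values form two disjoint closed sets covering
    the connected set [closure D]. *)
Lemma meets_constant (c : T -> R) : (forall K L, meets K L -> c K = c L) ->
  forall K L, c K = c L.
Proof.
move=> cKL K L; have [[_ _ connD] _ _ _] := polyD.
have /connected_closure := connD; set A := closure D => connA.
pose B (P : T -> Prop) := \bigcup_(M in [set M | P M]) @square R T M.
have closedB P : closed (B P).
  by apply: closed_bigcup => [|M _]; [exact: finite_finset|exact: square_closed].
have BA P : B P `<=` A by move=> z [M _ Mz]; apply/closure_square; exists M.
have : B (fun M => c M = c K) = A.
  apply: connA; first by exists (vertex K (false, false)); exists K => //; exact: vertex_square.
  - exists (~` B (fun M => c M <> c K)); first exact: closed_openC.
    apply/seteqP; split=> [z Bz|z [/closure_square[M Mz] nB]].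
      split; first exact: BA Bz.
      case: Bz => M cM Mz [M' cM' M'z]; apply: cM'; rewrite -cM.
      by apply: cKL; exact: square_meets M'z Mz.
    exists M => //=; apply: contrapT => cM; apply: nB; by exists M.
  - exists (B (fun M => c M = c K)) => //; apply/seteqP; split=> [z Bz|z []//].
    by split=> //; exact: BA Bz.
move=> BE; have : A (vertex L (false, false)).
  by apply/closure_square; exists L; exact: vertex_square.
rewrite -BE => -[M /= <- Mv]; apply: cKL.
exact: square_meets Mv (vertex_square _ _).
Qed.

Definition interior_square K z :=
  (corner K).1 < z.1 < (corner K).1 + side K /\
  (corner K).2 < z.2 < (corner K).2 + side K.

Definition centre K : R * R :=
  ((corner K).1 + side K / 2, (corner K).2 + side K / 2).

Lemma centre_interior K : interior_square K (centre K).
Proof.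
by have h0 := side_gt0 K; split; rewrite /centre /=; apply/andP; split; lra.
Qed.

Lemma interior_square_sub K z : interior_square K z -> square K z.
Proof.
by move=> [/andP[? ?] /andP[? ?]]; apply/squareP; split; apply/andP; split; lra.
Qed.

(** A point of the open square outside [D] would be a boundary point with a neighbourhood inside
    [closure D], a slit that [chart_not_interior] forbids. *)
Lemma interior_square_D K z : interior_square K z -> D z.
Proof.
have [[_ openD _] _ _ lipD] := polyD.
move=> [/andP[x0 x1] /andP[y0 y1]]; apply: contrapT => nDz.
have Kz : square K z by apply: interior_square_sub; split; apply/andP.
have [c [s [r [L [phi [cs1 r0 phiL chart]]]]]] := lipD z (square_boundary Kz nDz).
pose e := Num.min (Num.min (z.1 - (corner K).1) ((corner K).1 + side K - z.1))
   (Num.min (z.2 - (corner K).2) ((corner K).2 + side K - z.2)).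
have e0 : 0 < e by rewrite !lt_min; apply/andP; split; apply/andP; split; lra.
apply: (chart_not_interior cs1 r0 phiL chart e0 nDz) => w.
rewrite norm_pair_lt /= !lt_min => /andP[/andP[/andP[w1 w2] _] /andP[_ /andP[w3 w4]]].
move: w1 w2 w3 w4; rewrite !ltr_norml => /andP[? _] /andP[_ ?] /andP[? _] /andP[_ ?].
by apply/closure_square; exists K; apply/squareP; split; apply/andP; split; lra.
Qed.

Lemma near_interior_square K v e : square K v -> 0 < e ->
  exists2 z, interior_square K z & `|z - v| < e.
Proof.
move=> /squareP[/andP[x0 x1] /andP[y0 y1]] e0; have h0 := side_gt0 K.
pose t : R := Num.min (1 / 2) (e / (2 * side K)).
have t0 : 0 < t by rewrite lt_min !divr_gt0// mulr_gt0.
have t1 : t <= 1 / 2 by rewrite ge_min lexx.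
have te : t * side K < e.
  apply: (@le_lt_trans _ _ (e / 2)); last lra.
  rewrite -ler_pdivlMr// -mulrA -invfM; first by rewrite ge_min lexx orbT.
have th : 0 < t * side K by rewrite mulr_gt0.
have inside (a x : R) : a <= x -> x <= a + side K ->
    a < (1 - t) * x + t * (a + side K / 2) < a + side K /\
    `|(1 - t) * x + t * (a + side K / 2) - x| < e.
  move=> ax xa; have : 0 <= (1 - t) * (x - a) by rewrite mulr_ge0//; lra.
  have : 0 <= (1 - t) * (a + side K - x) by rewrite mulr_ge0//; lra.
  have : 0 <= t * (x - a) by rewrite mulr_ge0//; lra.
  have : 0 <= t * (a + side K - x) by rewrite mulr_ge0//; lra.
  by move=> ? ? ? ?; rewrite ltr_norml; split; apply/andP; split; lra.
have [xi xe] := inside _ _ x0 x1; have [yi ye] := inside _ _ y0 y1.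
exists ((1 - t) * v.1 + t * ((corner K).1 + side K / 2),
  (1 - t) * v.2 + t * ((corner K).2 + side K / 2)); first by split.
by rewrite norm_pair_lt /= xe ye.
Qed.

Lemma joined_interior_square K z w : interior_square K z -> interior_square K w ->
  joined (D `&` square K) z w.
Proof.
move=> [/andP[x0 x1] /andP[y0 y1]] [/andP[x0' x1'] /andP[y0' y1']].
apply: joined_segment => _ [t /= + <-]; rewrite in_itv/= => /andP[t0 t1].
suff Kt : interior_square K ((1 - t) *: z + t *: w).
  by split; [exact: interior_square_D Kt|exact: interior_square_sub].
have conv (a b x y : R) : a < x < b -> a < y < b -> a < (1 - t) * x + t * y < b.
  move=> /andP[ax xb] /andP[ay yb].
  have [t00|t00] := eqVneq t 0; first by rewrite t00 subr0 mul1r mul0r addr0 ax xb.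
  have tp : 0 < t by rewrite lt_neqAle eq_sym t00.
  have h1 : 0 <= (1 - t) * (x - a) by rewrite mulr_ge0//; lra.
  have h2 : 0 < t * (y - a) by rewrite mulr_gt0//; lra.
  have h3 : 0 <= (1 - t) * (b - x) by rewrite mulr_ge0//; lra.
  have h4 : 0 < t * (b - y) by rewrite mulr_gt0//; lra.
  by apply/andP; split; lra.
by rewrite segment_convex2; split=> /=; apply: conv; apply/andP.
Qed.

Definition near_square K (e : R) := [set z | exists2 w, square K w & `|z - w| < e].

(** The path leaves the centre of [K] for an interior point near a common point [v], crosses within
    a ball or chart at [v] to an interior point [z] of [L], and goes on to the centre of [L]. At
    [z], close to both squares, their functions can be compared. *)
Lemma meets_centres_joined K L e : meets K L -> 0 < e -> exists z,
  [/\ D z, square L z, near_square K e z,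
     joined (D `&` near_square K e) (centre K) z &
     joined (D `&` near_square L e) z (centre L)].
Proof.
move=> [v [Kv Lv]] e0; have [[_ openD _] _ _ lipD] := polyD.
have [d d0 dP] : exists2 d, 0 < d & forall z w, D z -> D w ->
    `|z - v| < d -> `|w - v| < d -> joined (D `&` [set p | `|p - v| < e]) z w.
  have [Dv|nDv] := pselect (D v); last first.
    have [c [s [r [Lp [phi [cs1 r0 phiL chart]]]]]] := lipD v (square_boundary Kv nDv).
    exact: (chart_joined cs1 r0 phiL chart).
  move: openD; rewrite openE => /(_ _ Dv)/nbhs_ballP[r /= r0 rD].
  exists (Num.min r e); first by rewrite lt_min r0.
  move=> z w Dz Dw; rewrite !lt_min => /andP[zr ze] /andP[wr we].
  have seg p : `|p - v| < r -> `|p - v| < e ->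
      joined (D `&` [set p | `|p - v| < e]) p v.
    move=> pr pe; apply: joined_segment => _ [t /= + <-]; rewrite in_itv/= => /andP[t0 t1].
    have -> : (1 - t) *: p + t *: v = (1 - t) *: (p - v) + v.
      by rewrite scalerBr -addrA; congr (_ + _); rewrite scalerBl scale1r opprB subrK.
    have small : `|(1 - t) *: (p - v)| <= `|p - v|.
      by rewrite normrZ ger0_norm ?subr_ge0// ler_piMl//; lra.
    split; last by rewrite /= addrK; exact: le_lt_trans small pe.
    by apply: rD; rewrite -ball_normE /= distrC addrK; exact: le_lt_trans small pr.
  exact: joined_trans (seg _ zr ze) (joined_sym (seg _ wr we)).
pose m := Num.min d e; have m0 : 0 < m by rewrite lt_min d0.
have [zK Kz zKm] := near_interior_square Kv m0.
have [zL Lz zLm] := near_interior_square Lv m0.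
move: zKm zLm; rewrite !lt_min => /andP[zKd zKe] /andP[zLd zLe].
have LzL := interior_square_sub Lz.
have near_sub M : D `&` square M `<=` D `&` near_square M e.
  by move=> p [Dp Mp]; split=> //; exists p; rewrite ?subrr ?normr0.
have near_v M : square M v ->
    D `&` [set p | `|p - v| < e] `<=` D `&` near_square M e.
  by move=> Mv p [Dp pv]; split=> //; exists v.
exists zL; split=> //; [exact: interior_square_D Lz|by exists v|..].
- apply: joined_trans (sub_joined (near_v _ Kv) _).
    exact: sub_joined (near_sub K) (joined_interior_square (centre_interior K) Kz).
  by apply: dP => //; [exact: interior_square_D Kz|exact: interior_square_D Lz].
- exact: sub_joined (near_sub L) (joined_interior_square Lz (centre_interior L)).
Qed.

End MeshedDomain.

(** * Globalization and exactness of the complex *)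

Section Exactness.
Variables (R : realType) (T : square_family R) (D : set (R * R)).
Hypotheses (polyD : polygonal_domain D) (meshD : mesh_of T D).
Local Notation P := {poly {poly R}}.
Local Notation "c %:PP" := (c%:P%:P : P) (at level 2, format "c %:PP").
Implicit Types (K L M : T).

Lemma mesh_nonempty : exists K : T, True.
Proof.
have [[[z Dz] _ _] _ _ _] := polyD.
by have [K _] := (closure_square meshD z).1 (subset_closure Dz); exists K.
Qed.

Lemma cocycle_trivial (d : T -> T -> R) : contractible D ->
  (forall K L M, meets K L -> meets L M -> meets K M -> d K L + d L M = d K M) ->
  exists c : T -> R, forall K L, meets K L -> d K L = c L - c K.
Proof.
move=> contrD dcoc; have [K0 _] := mesh_nonempty.
have [kappa kappaP] : {kappa : R * R -> T &
    forall z, closure D z -> square (kappa z) z}.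
  apply: (@choice _ _ (fun z K => closure D z -> square K z)) => z.
  have [/(closure_square meshD)[K Kz]|nz] := pselect (closure D z); first by exists K.
  by exists K0.
have kD z : D z -> square (kappa z) z by move=> /subset_closure/kappaP.
have [e e0 eP] := near_squares_meet T.
pose near K := D `&` near_square K e.
(* One compact carrier per pair of squares, empty for disjoint pairs; the finite union [C] is where
   [phi] is constructed. *)
have [A AP] : {A : T * T -> set (R * R) & forall p,
    [/\ compact (A p), A p `<=` D & meets p.1 p.2 -> exists z,
      [/\ D z, square p.2 z, near_square p.1 e z,
        linked (A p `&` near p.1) (centre p.1) z &
        linked (A p `&` near p.2) z (centre p.2)]]}.
  apply: (@choice _ _ (fun p (A : set (R * R)) => [/\ compact A, A `<=` D &
    meets p.1 p.2 -> exists z, [/\ D z, square p.2 z, near_square p.1 e z,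
        linked (A `&` near p.1) (centre p.1) z &
        linked (A `&` near p.2) z (centre p.2)]])) => -[K L] /=.
  have [KL|nKL] := pselect (meets K L); last first.
    by exists set0; split=> //; exact: compact0.
  have [z [Dz Lz Kz [A [cA AK] Al] [B [cB BL] Bl]]] := meets_centres_joined polyD meshD KL e0.
  exists (A `|` B); split; first exact: compactU.
    by move=> x [/AK[]|/BL[]].
  move=> _; exists z; split=> //.
    by apply: sub_linked Al => x Ax; split; [left|exact: AK].
  by apply: sub_linked Bl => x Bx; split; [right|exact: BL].
pose C := \big[setU/set0]_p A p.
have CE z : C z <-> exists p, A p z.
  rewrite /C -bigcup_seq; split=> [[p _ Ap]|[p Ap]]; first by exists p.
  by exists p => //=; rewrite mem_index_enum.
have cC : compact C by apply: bigsetU_compact => p _; have [] := AP p.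
have CD : C `<=` D by move=> z /CE[p]; have [_ AD _] := AP p; exact: AD.
pose g z w := d (kappa z) (kappa w).
have gcoc x y z : D x -> D y -> D z ->
    `|x - y| < e -> `|y - z| < e -> `|x - z| < e -> g x y + g y z = g x z.
  move=> /kD Dx /kD Dy /kD Dz xy yz xz; apply: dcoc.
  - exact: eP Dx Dy xy.
  - exact: eP Dy Dz yz.
  - exact: eP Dx Dz xz.
have [phi [eta eta0 phiP]] := contractible_potential contrD cC CD e0 gcoc.
(* Near [K], the increment [d (kappa x) (kappa y)] of [phi] cancels the change of the second term,
   by the cocycle rule on [kappa x], [kappa y], [K]. *)
pose f K z := phi z + d (kappa z) K.
have f_const K p x y : linked (A p `&` near K) x y -> f K x = f K y.
  move=> /(_ (f K) (Num.min eta e)); apply; first by rewrite lt_min eta0.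
  move=> {x y} x y [Ax [Dx [x' Kx xx']]] [Ay [Dy [y' Ky yy']]].
  rewrite lt_min => /andP[xyeta xye].
  have := phiP x y ((CE x).2 (ex_intro _ p Ax)) ((CE y).2 (ex_intro _ p Ay)) xyeta.
  have := dcoc _ _ _ (eP _ _ _ _ (kD _ Dx) (kD _ Dy) xye)
    (eP _ _ _ _ (kD _ Dy) Ky yy') (eP _ _ _ _ (kD _ Dx) Kx xx').
  rewrite /f /g; lra.
exists (fun K => f K (centre K)) => K L KL.
have [_ _ /(_ KL)[z [Dz Lz [w Kw zw] /f_const -> /f_const <-]]] := AP (K, L).
(* Both values have been moved to [z], where [phi z] cancels and the pairwise meeting squares
   [kappa z], [K], [L] give [d K L]. *)
rewrite /f /=.
have := dcoc _ _ _ (eP _ _ _ _ (kD _ Dz) Kw zw) KL (square_meets (kD _ Dz) Lz).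
lra.
Qed.

Lemma const_h_exact : exact_at [set 0 : R] id setT (@const_h R T).
Proof.
have [K _] := mesh_nonempty; apply/seteqP; split=> [_ [c /= -> <-]|c [_ c0]].
  by split=> //; apply/ffunP => L; rewrite !ffunE.
exists 0 => //=; move/ffunP: c0 => /(_ K); rewrite !ffunE.
by move=> /eqP; rewrite !polyC_eq0 => /eqP.
Qed.

Lemma A3Lambda0_const c : A3Lambda0 (@const_h R T c).
Proof.
split=> [K|K L i j _]; rewrite !ffunE; last first.
  by rewrite d1CC d2CC !ev0 !evCC.
apply/adini_shapeP; exists (fun i => if i is 0%N then c else 0).
by rewrite /adini_poly /= !mul0r !addr0.
Qed.

(** A curl-free function is piecewise constant; meeting squares of a conforming mesh share a vertex,
    where their constants agree. *)
Lemma curl_h_exact :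
  exact_at setT (@const_h R T) (@A3Lambda0 R T) (@curl_h R T).
Proof.
have [K0 _] := mesh_nonempty; have [_ cT] := meshD.
apply/seteqP; split=> [_ [c _ <-]|u [[uA uV] u0]].
  split; first exact: A3Lambda0_const.
  by apply/ffunP => K; rewrite !ffunE /curl d1CC d2CC oppr0.
pose c K := (u K)`_0`_0.
have uc K : u K = (c K)%:PP.
  by apply: curl_eq0; move/ffunP: u0 => /(_ K); rewrite !ffunE.
exists (c K0) => //; apply/ffunP => K; rewrite ffunE uc; congr (_%:PP).
apply: (meets_constant polyD meshD) => {K} L M [z [Lz Mz]].
have [->//|LM] := eqVneq L M.
have [i [j ij]] : exists i j, vertex L i = vertex M j.
  have zLM : (square L `&` square M) z by [].
  case: (cT _ _ LM) => [E|[i [j [ij _]]]|[e [f [/edge_inj[_ _ ef] _]]]].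
  - by move: zLM; rewrite E.
  - by exists i, j.
  - by have := ef 0; rewrite !edge_point0 => ?; do 2 eexists; eassumption.
by have := uV L M i j ij; rewrite !uc !evCC => -[].
Qed.

Lemma div_h_exact : contractible D ->
  exact_at (@A3Lambda0 R T) (@curl_h R T) (@A2Lambda1 R T) (@div_h R T).
Proof.
move=> contrD; have [_ cT] := meshD.
apply/seteqP; split=> [v v_curl|u [uA2 u0]].
  split; first exact: curl_A3_sub_A2.
  by case: v_curl => u _ <-; apply/ffunP => K; rewrite !ffunE div_curl.
have [uS uV uE] := uA2.
have [p pP] : {p : T -> P & forall K, adini_shape (p K) /\ u K = curl (p K)}.
  apply: (@choice _ _ (fun K q => adini_shape q /\ u K = curl q)) => K.
  have /vector_shapeP[q [c [qA uq]]] := uS K; exists q; split=> //.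
  move/ffunP: u0 => /(_ K); rewrite !ffunE uq div_vector_shape => /eqP.
  by rewrite !polyC_eq0 => /eqP ->; rewrite mul0r addr0.
have uE' : u = curl_h [ffun K => p K].
  by apply/ffunP => K; rewrite !ffunE (pP K).2.
have pdiff K L y z : square K y -> square L y -> square K z -> square L z ->
    ev (p L) y - ev (p K) y = ev (p L) z - ev (p K) z.
  move=> Ky Ly Kz Lz.
  have := @potential_diff _ _ [ffun K => p K] _ _ L K y z cT Ly Ky Lz Kz.
  by rewrite !ffunE; apply; [move=> M; rewrite ffunE; exact: (pP M).1|rewrite -uE'].
(* By [pdiff] the choice of the common point is immaterial; on disjoint squares the value is a
   default. *)
pose d K L := let y := get (square K `&` square L) in ev (p L) y - ev (p K) y.
have dE K L z : square K z -> square L z -> d K L = ev (p L) z - ev (p K) z.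
  by move=> Kz Lz; have [] := getPex (square_meets Kz Lz); move=> *; exact: pdiff.
have [c cP] : exists c : T -> R, forall K L, meets K L -> d K L = c L - c K.
  apply: cocycle_trivial => // K L M KL LM KM.
  have [z [Kz Lz Mz]] := helly KL LM KM.
  by rewrite (dE _ _ _ Kz Lz) (dE _ _ _ Lz Mz) (dE _ _ _ Kz Mz); ring.
(* Subtracting constants preserves the curls, and [c] removes exactly the jumps of the
   potentials. *)
exists [ffun K => p K - (c K)%:PP]; last first.
  apply/ffunP => K; rewrite !ffunE (pP K).2 /curl d1D d2D d1N d2N d1CC d2CC.
  by rewrite !oppr0 !addr0.
split=> [K|K L i j ij]; rewrite !ffunE.
  have /adini_shapeP[a ->] := (pP K).1.
  have /adini_shapeP[b bE] := (A3Lambda0_const (- c K)).1 K.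
  move: bE; rewrite ffunE !polyCN => ->.
  by apply/adini_shapeP; exists (a \+ b); rewrite -adini_polyD.
have Kv := vertex_square K i; have Lv : square L (vertex K i).
  by rewrite ij; exact: vertex_square.
have := cP _ _ (square_meets Kv Lv); rewrite (dE _ _ _ Kv Lv) => cd.
have := uV K L i j ij; rewrite !(pP _).2 /= !evN => -[/oppr_inj e1 e2].
rewrite !d1D !d2D !d1N !d2N !d1CC !d2CC !oppr0 !addr0 e1 e2 !evD !evN !evCC.
by congr (_, _, _); rewrite -ij; lra.
Qed.

End Exactness.

Unset Implicit Arguments.

Theorem lemma12 (R : realType) (Omega : set (R * R)) (T : square_family R) :
  polygonal_domain Omega -> contractible Omega -> mesh_of T Omega ->
  [/\ (@curl_h R T) @` (@A3Lambda0 R T) `<=` @A2Lambda1 R T,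
      (@div_h R T) @` (@A2Lambda1 R T) `<=` @A1Lambda2 R T &
      [/\ exact_at [set 0 : R] id setT (@const_h R T),
          exact_at setT (@const_h R T) (@A3Lambda0 R T) (@curl_h R T),
          exact_at (@A3Lambda0 R T) (@curl_h R T) (@A2Lambda1 R T) (@div_h R T)
        & exact_at (@A2Lambda1 R T) (@div_h R T) (@A1Lambda2 R T)
            (fun=> 0 : R)]].
Proof.
move=> polyD contrD meshD; have [_ cT] := meshD; split.
- exact: curl_A3_sub_A2.
- exact: div_A2_sub_A1.
- split.
  + exact: const_h_exact polyD meshD.
  + exact: curl_h_exact polyD meshD.
  + exact: div_h_exact polyD meshD contrD.
  + exact: div_onto cT.
Qed.
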